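(* Let $(G,\tau)$ be a $\mathrm{TempEuler}(k)$ instance such that every two consecutive times at any edge differ by at most $u$. There is an algorithm that decides whether $(G,\tau)$ is temporally Eulerian in time $2^{\mathcal{O}(ku)}\Lambda$, where $\Lambda$ is the lifetime of the input.
   Context: A temporal graph is a pair $(G,\tau)$ where $G$ is a finite simple graph and $\tau: E(G)\to 2^{\mathbb{N}}$ assigns to each edge $e$ a finite set $\tau(e)$ of times at which $e$ is active; $(e,t)$ with $t\in\tau(e)$ is a time-edge. The lifetime is $\Lambda=\max_e\max\tau(e)$. A (strict) temporal $(x,y)$-walk is a sequence of time-edges $(e_1,t_1),\dots,(e_n,t_n)$ with $e_1,\dots,e_n$ a walk from $x$ to $y$ in $G$ and $t_1<\dots<t_n$; closed if $x=y$. A temporal Eulerian circuit is a closed temporal walk whose edge sequence is an Euler circuit of $G$; $(G,\tau)$ is temporally Eulerian if it has one. A $\mathrm{TempEuler}(k)$ instance is a temporal graph with $|\tau(e)|\le k$ for all $e$. ''Consecutive times'' at $e$ are elements $t<t'$ of $\tau(e)$ with no element of $\tau(e)$ strictly between them. *)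

(* Defs.v *)
From HB Require Import structures.
From mathcomp Require Import all_boot finmap.

Set Implicit Arguments.
Unset Strict Implicit.
Unset Printing Implicit Defensive.

(* The value of [tg_times] outside [tg_edges] is irrelevant. *)
Record temporal_graph (V : finType) := TemporalGraph {
  tg_edges : {set {set V}};
  tg_simple : forall e, e \in tg_edges -> #|e| = 2;
  tg_times : {set V} -> {fset nat}
}.

Section TemporalGraphs.
Variables (V : finType) (G : temporal_graph V).

(* 0 when there is no time-edge. *)
Definition lifetime : nat :=
  \max_(e in tg_edges G) \max_(t <- tg_times G e) t.

Fixpoint walk (x : V) (es : seq {set V}) (y : V) : Prop :=
  if es is e :: es' then
    e \in tg_edges G /\ exists2 z, e = [set x; z] & walk z es' y
  else x = y.

Definition temporal_walk (x y : V) (w : seq ({set V} * nat)) : Prop :=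
  [/\ walk x (unzip1 w) y,
      (forall et, et \in w -> et.2 \in tg_times G et.1)
    & sorted ltn (unzip2 w)].

Definition euler_circuit (es : seq {set V}) : Prop :=
  (exists x, walk x es x) /\
  (forall e, e \in tg_edges G -> count_mem e es = 1).

Definition temporal_euler_circuit (w : seq ({set V} * nat)) : Prop :=
  (exists x, temporal_walk x x w) /\ euler_circuit (unzip1 w).

Definition temporally_eulerian : Prop := exists w, temporal_euler_circuit w.

Definition temp_euler_instance (k : nat) : Prop :=
  forall e, e \in tg_edges G -> (#|` tg_times G e|)%fset <= k.

Definition consecutive_times (e : {set V}) (t t' : nat) : Prop :=
  [/\ t \in tg_times G e, t' \in tg_times G e, t < t'
    & forall s, s \in tg_times G e -> ~~ (t < s < t')].

Definition consecutive_gaps_at_most (u : nat) : Prop :=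
  forall e, e \in tg_edges G ->
  forall t t', consecutive_times e t t' -> t' - t <= u.

(* An input word lists the number of vertices, the number of edges and then,
   for each edge, its two endpoints, its number of times and its times.  The
   numbering of the vertices and all orderings are arbitrary: a graph has many
   encodings, and an algorithm has to cope with each of them. *)
Definition encode_edge (num : V -> nat) (r : V * V * seq nat) : seq nat :=
  [:: num r.1.1, num r.1.2, size r.2 & r.2].

Definition encodes (input : seq nat) : Prop :=
  exists (num : V -> nat) (rs : seq (V * V * seq nat)),
  [/\ injective num /\ (forall x, num x < #|V|),
      perm_eq [seq [set r.1.1; r.1.2] | r <- rs] (enum (tg_edges G)),
      (forall r, r \in rs -> perm_eq r.2 (tg_times G [set r.1.1; r.1.2]))
    & input = [:: #|V|, size rs & flatten (map (encode_edge num) rs)] ].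

End TemporalGraphs.

(* Uniform-cost random access machine, with structured control flow.  A program
   mentions finitely many registers and finitely many arrays, all holding
   natural numbers.  Addition and truncated subtraction are the only arithmetic
   operations; there is no multiplication, so that charging one unit for each
   operation, whatever the size of its operands, is the usual time measure. *)
Inductive expr : Type :=
| Const of nat
| Reg of nat
| Read of nat & expr  (* [Read a e] is cell [e] of array [a] *)
| Add of expr & expr
| Sub of expr & expr.

(* [If] and [While] test whether an expression is nonzero. *)
Inductive program : Type :=
| Skip
| Assign of nat & expr
| Write of nat & expr & expr  (* [Write a e1 e2] stores [e2] in cell [e1] of [a] *)
| Seq of program & program
| If of expr & program & program
| While of expr & program.

Record state := State { reg : nat -> nat; arr : nat -> nat -> nat }.

Fixpoint eval (s : state) (e : expr) : nat :=
  match e with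
  | Const n => n
  | Reg x => reg s x
  | Read a e1 => arr s a (eval s e1)
  | Add e1 e2 => eval s e1 + eval s e2
  | Sub e1 e2 => eval s e1 - eval s e2
  end.

Fixpoint expr_cost (e : expr) : nat :=
  match e with
  | Const _ | Reg _ => 1
  | Read _ e1 => (expr_cost e1).+1
  | Add e1 e2 | Sub e1 e2 => (expr_cost e1 + expr_cost e2).+1
  end.

Definition set_reg (s : state) (x v : nat) : state :=
  State (fun y => if y == x then v else reg s y) (arr s).

Definition set_arr (s : state) (a i v : nat) : state :=
  State (reg s)
    (fun b j => if (b == a) && (j == i) then v else arr s b j).

(* [exec p s n s']: run from [s], the program [p] halts in [s'] after exactly
   [n] time units. *)
Inductive exec : program -> state -> nat -> state -> Prop :=
| ExecSkip s : exec Skip s 1 s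
| ExecAssign x e s :
    exec (Assign x e) s (expr_cost e).+1 (set_reg s x (eval s e))
| ExecWrite a e1 e2 s :
    exec (Write a e1 e2) s (expr_cost e1 + expr_cost e2).+1
      (set_arr s a (eval s e1) (eval s e2))
| ExecSeq p q s s1 s2 m n :
    exec p s m s1 -> exec q s1 n s2 -> exec (Seq p q) s (m + n) s2
| ExecIfTrue e p q s s' n :
    eval s e != 0 -> exec p s n s' ->
    exec (If e p q) s (expr_cost e + n).+1 s'
| ExecIfFalse e p q s s' n :
    eval s e = 0 -> exec q s n s' ->
    exec (If e p q) s (expr_cost e + n).+1 s'
| ExecWhileTrue e p s s1 s2 m n :
    eval s e != 0 -> exec p s m s1 -> exec (While e p) s1 n s2 ->
    exec (While e p) s (expr_cost e + m + n).+1 s2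
| ExecWhileFalse e p s :
    eval s e = 0 -> exec (While e p) s (expr_cost e).+1 s.

(* The input word is in array 0; all other cells and all registers are 0. *)
Definition initial_state (input : seq nat) : state :=
  State (fun _ => 0) (fun a i => if a == 0 then nth 0 input i else 0).

Definition accepting (s : state) : Prop := reg s 0 != 0.

(* The program halts on [input] within [T] time units, and accepts exactly when
   [Q] holds. *)
Definition decides_within (p : program) (input : seq nat) (T : nat) (Q : Prop) :
    Prop :=
  exists (n : nat) (s : state),
    [/\ exec p (initial_state input) n s, n <= T & accepting s <-> Q].

(* Main.v *)
(* Write f(e) and l(e) for the first and last time of an edge e, and d for the
   largest l(e) - f(e); the gap condition gives d <= k u.  All edges e with
   f(e) <= t <= l(e) have to be used at distinct times of [t - d, t + d], so an
   instance in which more than 2d+1 edges straddle some t is rejected.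
   Otherwise sweep over the times t, keeping the trails that use only times
   below t and contain every edge with l(e) < t.  Such a trail leaves open only
   which of the straddling edges it has used, and by parity of degrees its end
   is determined by its start and its edge set; so one trail per start and edge
   set is enough.  The first edge of a circuit starts no later than any edge
   ends, which leaves at most 2(2d+1) candidate starts.  Hence 2^O(d) trails are
   kept at each time.  Edge sets are compared through their codes, sums of
   distinct powers of two (numbers with one bit per edge of the graph, which are
   added and compared in unit time), and membership of an edge e in a trail is tested by
   following the trail backwards until time f(e), which takes at most d steps. *)

Require Import Defs.
From mathcomp Require Import all_boot finmap zify.
(* [all_boot] shadows the constructor [Sub] of [expr]. *)
Import Defs.

Set Implicit Arguments.
Unset Strict Implicit.
Unset Printing Implicit Defensive.

(** * Timed executions *)

(** The program is given neither [k] nor [u], and its input may be far longer than the time allowed,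
    since many edges can share few times. So overload is tested while the edges are being read,
    against the largest span of the edges read so far. This is sound because the counting argument
    holds for every prefix of the edges with the span of that prefix. It also bounds the reading:
    every edge straddles its own first time, so at most [(Λ + 1)(2 k u + 1)] edges can be read
    without a rejection. Duplicate trails are recognised by one lookup in a table indexed by codes.
    Its entries carry the time at which they were made, because clearing the table for each time
    would be too expensive. Trails share their initial parts as linked lists, so storing an
    extension takes constant time. Of the resulting factor [2^(5 k u)], three powers of [2^(k u)]
    bound the number of records kept at one time and two bound the work on each of them. *)

(** A timed total-correctness statement about one fixed initial state, so that [Q] can refer to
    values in [s] without auxiliary variables. *)
Definition runs (p : program) (s : state) (T : nat) (Q : state -> Prop) : Prop :=
  exists n s', [/\ exec p s n s', n <= T & Q s'].

Fixpoint reg_mods (p : program) : seq nat :=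
  match p with
  | Assign x _ => [:: x]
  | Seq p q | If _ p q => reg_mods p ++ reg_mods q
  | While _ p => reg_mods p
  | _ => [::]
  end.

Fixpoint arr_mods (p : program) : seq nat :=
  match p with
  | Write a _ _ => [:: a]
  | Seq p q | If _ p q => arr_mods p ++ arr_mods q
  | While _ p => arr_mods p
  | _ => [::]
  end.

(** Read off the syntax, so that no specification has to list what a program leaves alone; [fr.1]
    and [fr.2] recover it where it is used. *)
Definition framed (p : program) (s s' : state) : Prop :=
  (forall x, x \notin reg_mods p -> reg s' x = reg s x) /\
  (forall a i, a \notin arr_mods p -> arr s' a i = arr s a i).

Lemma framed_refl p s : framed p s s.
Proof. by []. Qed.

Lemma framed_trans p s1 s2 s3 :
  framed p s1 s2 -> framed p s2 s3 -> framed p s1 s3.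
Proof.
by move=> [r1 a1] [r2 a2]; split=> *; rewrite ?r2 ?a2 // ?r1 ?a1.
Qed.

Lemma exec_framed p s n s' : exec p s n s' -> framed p s s'.
Proof.
elim=> {p s n s'}.
- by [].
- by move=> x e s; split=> //= y; rewrite inE => /negbTE->.
- by move=> a e1 e2 s; split=> //= b i; rewrite inE => /negbTE->.
- move=> p q s s1 s2 m n _ [r1 a1] _ [r2 a2].
  by split=> [x|a i] /=; rewrite mem_cat negb_or => /andP[h1 h2];
    rewrite ?r2 ?a2 // ?r1 ?a1.
- move=> e p q s s' n _ _ [r1 a1].
  by split=> [x|a i] /=; rewrite mem_cat negb_or => /andP[h1 h2];
    rewrite ?r1 ?a1.
- move=> e p q s s' n _ _ [r1 a1].
  by split=> [x|a i] /=; rewrite mem_cat negb_or => /andP[h1 h2];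
    rewrite ?r1 ?a1.
- move=> e p s s1 s2 m n _ _ h1 _ h2.
  exact: framed_trans h1 h2.
- by [].
Qed.

Lemma runs_weaken p s T T' (Q Q' : state -> Prop) :
  runs p s T Q -> T <= T' -> (forall s', framed p s s' -> Q s' -> Q' s') ->
  runs p s T' Q'.
Proof.
case=> n [s' [ex le q]] leT imp; exists n, s'; split=> //; first exact: leq_trans leT.
exact: imp (exec_framed ex) q.
Qed.

Lemma runs_seq p q s T1 T2 T (Q1 Q : state -> Prop) :
  runs p s T1 Q1 ->
  (forall s1, framed p s s1 -> Q1 s1 -> runs q s1 T2 Q) ->
  T1 + T2 <= T -> runs (Seq p q) s T Q.
Proof.
case=> m [s1 [ex1 le1 q1]] h leT.
have [n [s2 [ex2 le2 q2]]] := h _ (exec_framed ex1) q1.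
exists (m + n), s2; split=> //; first exact: ExecSeq ex1 ex2.
by apply: leq_trans leT; rewrite leq_add.
Qed.

Lemma runs_if e p q s T (Q : state -> Prop) :
  (eval s e != 0 -> runs p s T Q) -> (eval s e = 0 -> runs q s T Q) ->
  runs (If e p q) s (expr_cost e + T).+1 Q.
Proof.
case: (eqVneq (eval s e) 0) => [e0 _ /(_ e0)|e1 /(_ isT) h _].
  case=> n [s' [ex le qq]]; exists (expr_cost e + n).+1, s'.
  by split=> //; [exact: ExecIfFalse | rewrite ltnS leq_add2l].
case: h => n [s' [ex le qq]]; exists (expr_cost e + n).+1, s'.
by split=> //; [exact: ExecIfTrue | rewrite ltnS leq_add2l].
Qed.

(* [n] bounds the number of iterations still to come. *)
Lemma runs_while e p (I : nat -> state -> Prop) C (Q : state -> Prop) n s :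
  I n s ->
  (forall n1 s1, framed p s s1 -> I n1 s1 -> eval s1 e != 0 ->
     0 < n1 /\ runs p s1 C (I n1.-1)) ->
  (forall n1 s1, framed p s s1 -> I n1 s1 -> eval s1 e = 0 -> Q s1) ->
  runs (While e p) s (n * (expr_cost e + C).+1 + (expr_cost e).+1) Q.
Proof.
move=> i0 hI hQ.
suff main : forall n1 s1, framed p s s1 -> I n1 s1 ->
  runs (While e p) s1 (n1 * (expr_cost e + C).+1 + (expr_cost e).+1) Q.
  by apply: main i0; exact: framed_refl.
elim=> [|n1 IH] s1 fr i1; case: (eqVneq (eval s1 e) 0) => e0.
- exists (expr_cost e).+1, s1; split; [exact: ExecWhileFalse| lia | exact: hQ fr i1 e0].
- by have [] := hI _ _ fr i1 e0.
- exists (expr_cost e).+1, s1; split; [exact: ExecWhileFalse| lia | exact: hQ fr i1 e0].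
- have [_ [m [s2 [ex le i2]]]] := hI _ _ fr i1 e0.
  have [m' [s3 [ex' le' q3]]] := IH _ (framed_trans fr (exec_framed ex)) i2.
  exists (expr_cost e + m + m').+1, s3; split=> //; first exact: ExecWhileTrue ex ex'.
  by rewrite mulSn; lia.
Qed.

Fixpoint loop_free (p : program) : bool :=
  match p with
  | Seq p q | If _ p q => loop_free p && loop_free q
  | While _ _ => false
  | _ => true
  end.

(** Loop-free code is executed by computation. The value for [While] is a dummy, excluded by
    [loop_free]. *)
Fixpoint run_lf (p : program) (s : state) : state :=
  match p with
  | Skip | While _ _ => s
  | Assign x e => set_reg s x (eval s e)
  | Write a e1 e2 => set_arr s a (eval s e1) (eval s e2)
  | Seq p q => run_lf q (run_lf p s)
  | If e p q => if eval s e == 0 then run_lf q s else run_lf p s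
  end.

(** Both branches of an [If] are charged; the cost is then independent of the state and computes to
    a numeral. *)
Fixpoint lf_cost (p : program) : nat :=
  match p with
  | Skip | While _ _ => 1
  | Assign _ e => (expr_cost e).+1
  | Write _ e1 e2 => (expr_cost e1 + expr_cost e2).+1
  | Seq p q => lf_cost p + lf_cost q
  | If e p q => (expr_cost e + (lf_cost p + lf_cost q)).+1
  end.

Lemma runs_lf p s T (Q : state -> Prop) :
  loop_free p -> lf_cost p <= T -> Q (run_lf p s) -> runs p s T Q.
Proof.
move=> lf le q; suff [n [s' [ex len q']]] : runs p s (lf_cost p) Q.
  by exists n, s'; split=> //; apply: leq_trans le.
elim: p s Q lf {T le} q => /=.
- by move=> s Q _ q; exists 1, s; split=> //; exact: ExecSkip.
- by move=> x e s Q _ q; eexists _, _; split; [exact: ExecAssign| |].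
- by move=> a e1 e2 s Q _ q; eexists _, _; split; [exact: ExecWrite| |].
- move=> p IHp q IHq s Q /andP[lp lq] h.
  apply: (runs_seq (Q1 := fun s' => s' = run_lf p s)) (leqnn _).
    exact: IHp.
  by move=> s1 _ ->; exact: IHq.
- move=> e p IHp q IHq s Q /andP[lp lq] h; apply: runs_if => he.
    apply: runs_weaken (IHp s Q lp _) _ _ => //; last by rewrite leq_addr.
    by move: h; rewrite (negbTE he).
  apply: runs_weaken (IHq s Q lq _) _ _ => //; last by rewrite leq_addl.
  by move: h; rewrite he.
- by [].
Qed.

Lemma runs_seq_lf p q s T T2 (Q : state -> Prop) :
  loop_free p -> lf_cost p + T2 <= T ->
  (forall s1, framed p s s1 -> s1 = run_lf p s -> runs q s1 T2 Q) ->
  runs (Seq p q) s T Q.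
Proof.
move=> lf le h; apply: (runs_seq (Q1 := fun s' => s' = run_lf p s)) h le.
exact: runs_lf.
Qed.

(** * The search over partial trails *)

Lemma uniq_map_inj (T T' : eqType) (f : T -> T') (s : seq T) :
  uniq (map f s) -> {in s &, injective f}.
Proof.
elim: s => //= x s IH /andP[xs us] y z; rewrite !inE.
move=> /orP[/eqP->|ys] /orP[/eqP->|zs] // eqf; last exact: IH.
  by rewrite eqf map_f in xs.
by rewrite -eqf map_f in xs.
Qed.

Lemma binary_lt n (f : nat -> bool) : \sum_(i < n) f i * 2 ^ i < 2 ^ n.
Proof.
elim: n => [|n IH]; first by rewrite big_ord0.
by rewrite big_ord_recr /= expnS mul2n -addnn -addSn leq_add //; case: (f n);
  rewrite ?mul1n.
Qed.

(** The lower digits sum to less than [2 ^ n], which forces the leading digits to agree. *)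
Lemma binary_inj n (f g : nat -> bool) :
  \sum_(i < n) f i * 2 ^ i = \sum_(i < n) g i * 2 ^ i ->
  forall i, i < n -> f i = g i.
Proof.
elim: n => // n IH; rewrite !big_ord_recr /= => eqs.
have fn := binary_lt n f; have gn := binary_lt n g.
have fg : f n = g n.
  move: eqs fn gn; move: (2 ^ n) (\sum_(i < n) _) (\sum_(i < n) _) => p a b.
  by case: (f n); case: (g n) => //; lia.
move=> i; rewrite ltnS leq_eqVlt => /orP[/eqP->//|]; apply: IH.
by move: eqs; rewrite fg => /addIn.
Qed.

Lemma sum_uniq_binary n (s : seq nat) : uniq s -> {in s, forall e, e < n} ->
  \sum_(e <- s) 2 ^ e = \sum_(i < n) (val i \in s) * 2 ^ i.
Proof.
move=> us lts; have pe : perm_eq s [seq i <- iota 0 n | i \in s].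
  apply: uniq_perm => //; first by rewrite filter_uniq ?iota_uniq.
  move=> e; rewrite mem_filter mem_iota /=.
  by case: (boolP (e \in s)) => //= /lts ->.
rewrite (perm_big _ pe) big_filter -[n in iota _ n]subn0 -/(index_iota 0 n).
by rewrite big_mkord big_mkcond; apply: eq_bigr => i _; case: (_ \in s); lia.
Qed.

Section Instance.

Variable es : seq (nat * nat * seq nat).

Let m := size es.

Definition edge i := nth (0, 0, [::]) es i.
Definition end1 i := (edge i).1.1.
Definition end2 i := (edge i).1.2.
Definition times i := (edge i).2.
(** A left fold, as the program computes it while reading. The minimum has to start from a listed
    time, whereas the maximum in [last_time] can start from 0. *)
Definition first i := foldl minn (head 0 (times i)) (times i).
Definition last_time i := foldl maxn 0 (times i).

Lemma foldl_minn_le x0 (s : seq nat) t : t \in x0 :: s -> foldl minn x0 s <= t.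
Proof.
elim: s x0 t => [|y s IH] x0 t; first by rewrite inE => /eqP->.
move=> /=; rewrite !inE => /or3P[/eqP->|/eqP->|h].
- exact: leq_trans (IH _ _ (mem_head _ _)) (geq_minl x0 y).
- exact: leq_trans (IH _ _ (mem_head _ _)) (geq_minr x0 y).
- by apply: IH; rewrite inE h orbT.
Qed.

Lemma foldl_minn_in x0 (s : seq nat) : foldl minn x0 s \in x0 :: s.
Proof.
elim: s x0 => [|y s IH] x0 /=; first by rewrite inE.
have := IH (minn x0 y); rewrite !inE => /orP[/eqP h|->]; last by rewrite !orbT.
by rewrite h; case: (leqP x0 y); rewrite eqxx ?orbT.
Qed.

Lemma foldl_maxn_ge x0 (s : seq nat) t : t \in x0 :: s -> t <= foldl maxn x0 s.
Proof.
elim: s x0 t => [|y s IH] x0 t; first by rewrite inE => /eqP->.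
move=> /=; rewrite !inE => /or3P[/eqP->|/eqP->|h].
- exact: leq_trans (leq_maxl x0 y) (IH _ _ (mem_head _ _)).
- exact: leq_trans (leq_maxr x0 y) (IH _ _ (mem_head _ _)).
- by apply: IH; rewrite inE h orbT.
Qed.

Lemma foldl_maxn_in x0 (s : seq nat) : foldl maxn x0 s \in x0 :: s.
Proof.
elim: s x0 => [|y s IH] x0 /=; first by rewrite inE.
have := IH (maxn x0 y); rewrite !inE => /orP[/eqP h|->]; last by rewrite !orbT.
by rewrite h; case: (leqP x0 y); rewrite eqxx ?orbT.
Qed.

Lemma first_le i t : t \in times i -> first i <= t.
Proof. by move=> h; apply: foldl_minn_le; rewrite inE h orbT. Qed.

Lemma last_time_ge i t : t \in times i -> t <= last_time i.
Proof. by move=> h; apply: foldl_maxn_ge; rewrite inE h orbT. Qed.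

Lemma first_in i : times i != [::] -> first i \in times i.
Proof.
rewrite /first; case: (times i) => // x s _.
by have := foldl_minn_in x (x :: s); rewrite [head _ _]/= !inE orbA orbb.
Qed.

Lemma last_time_in i : times i != [::] -> last_time i \in times i.
Proof.
rewrite /last_time; case: (times i) => // x s _.
by have := foldl_maxn_in x s; rewrite /= max0n.
Qed.

(* The edges active at time [t], among the first [n], latest first: the order
   in which the buckets of the program hold them. *)
Fixpoint active n t : seq nat :=
  if n is n'.+1 then
    if t \in times n' then n' :: active n' t else active n' t
  else [::].

(** The prefix length [n] is a parameter here and below because the load is tested after each edge
    that is read. *)
Fixpoint coverage n t : nat :=
  if n is n'.+1 then coverage n' t + (first n' <= t <= last_time n') else 0.

Fixpoint max_span n : nat :=
  if n is n'.+1 then maxn (max_span n') (last_time n' - first n') else 0.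

Fixpoint horizon n : nat :=
  if n is n'.+1 then maxn (horizon n') (last_time n').+1 else 0.

Lemma mem_active n t e : (e \in active n t) = (e < n) && (t \in times e).
Proof.
elim: n => //= n IH; have -> : (e < n.+1) = (e == n) || (e < n) by rewrite ltnS
  leq_eqVlt.
case: ifP => h; rewrite ?inE IH.
  by case: eqVneq => [->|_] //=; rewrite h.
by case: eqVneq => [->|_] //=; rewrite h !andbF.
Qed.

Lemma active_uniq n t : uniq (active n t).
Proof.
elim: n => //= n IH; case: ifP => //= h.
by rewrite IH mem_active ltnn.
Qed.

Lemma size_active_cover n t : size (active n t) <= coverage n t.
Proof.
elim: n => //= n IH; case: ifP => /= h; last lia.
by rewrite (first_le h) (last_time_ge h) addn1.
Qed.

Lemma span_le_max_span n i : i < n -> last_time i - first i <= max_span n.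
Proof.
elim: n => //= n IH; rewrite ltnS leq_eqVlt => /orP[/eqP->|/IH h]; lia.
Qed.

Lemma max_span_le n d :
  (forall i, i < n -> last_time i - first i <= d) -> max_span n <= d.
Proof.
elim: n => //= n IH h; rewrite geq_max h // IH // => i lt; apply: h; exact: ltnW.
Qed.

Lemma lt_horizon n i : i < n -> last_time i < horizon n.
Proof.
elim: n => //= n IH; rewrite ltnS leq_eqVlt => /orP[/eqP->|/IH h]; lia.
Qed.

Lemma horizon_le n N :
  (forall i, i < n -> last_time i < N) -> horizon n <= N.
Proof.
elim: n => //= n IH h; rewrite geq_max h // IH // => i lt; apply: h; exact: ltnW.
Qed.

Lemma coverE n t :
  coverage n t = count (fun i => first i <= t <= last_time i) (iota 0 n).
Proof.
elim: n => [|n IH] //; rewrite -[in RHS]addn1 iotaD count_cat /= IH add0n addn0 //.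
Qed.

(** Each edge contributes at its own first time. Combined with a bound on the load, this bounds the
    number of edges by the lifetime. *)
Lemma leq_sum_cover n N :
  (forall i, i < n -> first i <= last_time i < N) ->
  n <= \sum_(t < N) coverage n t.
Proof.
elim: n => // n IH h /=; rewrite big_split /= -addn1 leq_add //.
  by apply: IH => i lt; apply: h; exact: ltnW.
have /andP[fl lN] := h n (ltnSn n).
by rewrite (bigD1 (Ordinal (leq_ltn_trans fl lN))) //= leqnn fl.
Qed.

(* Walks are lists of pairs (edge, time), with the last step first. *)
Definition incident e v := (v == end1 e) || (v == end2 e).
(** For [v] incident with [e], the other end, computed without a test by the arithmetic of the
    machine. *)
Definition opposite e v := end1 e + end2 e - v.

Fixpoint endpoint (x : nat) (w : seq (nat * nat)) : nat :=
  if w is et :: w' then opposite et.1 (endpoint x w') else x.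

Fixpoint trail (x : nat) (w : seq (nat * nat)) : bool :=
  if w is et :: w' then
    [&& et.1 < m, et.2 \in times et.1, incident et.1 (endpoint x w'),
        et.1 \notin unzip1 w', all (fun t => t < et.2) (unzip2 w') & trail x w']
  else true.

Lemma trail_uniq x w : trail x w -> uniq (unzip1 w).
Proof. by elim: w => //= et w IH /and5P[_ _ _ -> /andP[_ /IH]]. Qed.

Lemma trail_lt x w e : trail x w -> e \in unzip1 w -> e < m.
Proof.
elim: w => //= et w IH /and5P[lt _ _ _ /andP[_ tr]].
by rewrite inE => /orP[/eqP->|/(IH tr)].
Qed.

Lemma trail_uniq_times x w : trail x w -> uniq (unzip2 w).
Proof.
elim: w => //= et w IH /and5P[_ _ _ _ /andP[/allP h /IH->]]; rewrite andbT.
by apply/negP => /h; rewrite ltnn.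
Qed.

Lemma trail_times x w et : trail x w -> et \in w -> et.2 \in times et.1.
Proof.
elim: w => //= et' w IH /and5P[_ h _ _ /andP[_ tr]].
by rewrite inE => /orP[/eqP->|/(IH tr)].
Qed.

Lemma trail_perm x w : trail x w -> size w = m -> perm_eq (unzip1 w) (iota 0 m).
Proof.
move=> tr sz; apply: uniq_perm (trail_uniq tr) (iota_uniq _ _) _.
have sub : {subset unzip1 w <= iota 0 m}.
  by move=> e /(trail_lt tr); rewrite mem_iota.
by have [] := uniq_min_size (trail_uniq tr) sub _; rewrite ?size_iota ?size_map ?sz.
Qed.

(** Only the first [n] edges and their own span bound [d] enter, although the trail covers all
    edges. This justifies rejecting before the remaining edges have been read. *)
Lemma cover_le_trail x w n t d :
  trail x w -> size w = m -> n <= m ->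
  (forall i, i < n -> last_time i - first i <= d) ->
  coverage n t <= d.*2.+1.
Proof.
move=> tr sz le span.
pose P := fun i => (i < n) && (first i <= t <= last_time i).
have -> : coverage n t = count P (iota 0 n).
  rewrite coverE; apply: eq_in_count => i; rewrite mem_iota /P add0n.
  by move=> /andP[_ ->].
have le1 : count P (iota 0 n) <= count P (unzip1 w).
  rewrite (permP (trail_perm tr sz)) -(subnKC le) iotaD count_cat; exact: leq_addr.
apply: leq_trans le1 _.
rewrite count_map -size_filter -(size_map snd).
(* The straddling edges are counted by their distinct times of use. If [t < d], the window starts at
   0 by truncation, and its [2d + 1] values still reach [t + d]. *)
rewrite -(size_iota (t - d) d.*2.+1); apply: uniq_leq_size.
  have := trail_uniq_times tr; apply: subseq_uniq.
  by apply: map_subseq; exact: filter_subseq.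
move=> t1; rewrite mem_iota => /mapP[[e t2]]; rewrite mem_filter =>
  /andP[/= /andP[lt /andP[f l]] inw] ->.
have h := trail_times tr inw.
have := first_le h; have := last_time_ge h; have := span _ lt.
move: f l; rewrite /= -addnn; lia.
Qed.

(** * Dynamic programming over pairs of a start and an edge set *)

Section Search.

Hypothesis loopless : forall i, i < m -> end1 i != end2 i.
Hypothesis nonempty : forall i, i < m -> times i != [::].

(** A step flips the parity at its two ends, which differ as there are no loops. The flips telescope
    along the trail to the start and the end, and these cancel if they coincide. *)
Lemma odd_degree x w z : trail x w ->
  odd (count (incident^~ z) (unzip1 w)) = (z == x) (+) (z == endpoint x w).
Proof.
elim: w => [_|et w IH] /=; first by rewrite addbb.
move=> /and5P[lt _ inc _ /andP[_ tr]]; rewrite oddD IH //.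
have := loopless lt; move: inc; rewrite /incident /opposite.
set v := endpoint x w; rewrite oddb.
move=> /orP[]/eqP->; rewrite ?addKn ?addnK => ne.
  have : ~~ ((z == end1 et.1) && (z == end2 et.1)).
    by apply: contra ne => /andP[/eqP<- /eqP<-].
  by case: (z == x); case: (z == end1 _); case: (z == end2 _).
have : ~~ ((z == end1 et.1) && (z == end2 et.1)).
  by apply: contra ne => /andP[/eqP<- /eqP<-].
by case: (z == x); case: (z == end1 _); case: (z == end2 _).
Qed.

(* The end of a trail is read off the parities of the degrees. *)
Lemma endpoint_perm x w w' : trail x w -> trail x w' ->
  unzip1 w =i unzip1 w' -> endpoint x w = endpoint x w'.
Proof.
move=> tr tr' eqw; have pe : perm_eq (unzip1 w) (unzip1 w').
  by apply: uniq_perm => //; apply: trail_uniq; eassumption.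
have := odd_degree (endpoint x w) tr'.
rewrite -(permP pe) (odd_degree _ tr) eqxx => /addbI/esym/eqP; exact.
Qed.

Variable starts : seq nat.

(* A search record [(j, w)] is a trail [w] from the [j]-th candidate start. *)
Definition origin (r : nat * seq (nat * nat)) := nth 0 starts r.1.
(** The sum is below [2 ^ m], so quotient and remainder recover the start index and the edge set. *)
Definition code (r : nat * seq (nat * nat)) :=
  r.1 * 2 ^ m + \sum_(e <- unzip1 r.2) 2 ^ e.

Definition missing t (w : seq (nat * nat)) :=
  count (fun e => (e \notin unzip1 w) && (last_time e <= t)) (active m t).

Definition extends t r e :=
  [&& e \notin unzip1 r.2, incident e (endpoint (origin r) r.2)
    & missing t r.2 - (last_time e <= t) == 0].

Definition successors t r :=
  (if missing t r.2 == 0 then [:: r] else [::]) ++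
  [seq (r.1, (e, t) :: r.2) | e <- active m t & extends t r e].

Definition push L r := if code r \in map code L then L else rcons L r.

Definition search_step t L := foldl push [::] (flatten (map (successors t) L)).

Definition good_record t r :=
  [/\ r.1 < size starts, trail (origin r) r.2, all (fun t' => t' < t) (unzip2 r.2)
    & forall e, e < m -> last_time e < t -> e \in unzip1 r.2].

Definition same_record (r r' : nat * seq (nat * nat)) :=
  r.1 = r'.1 /\ unzip1 r.2 =i unzip1 r'.2.

Lemma code_inj t t' r r' : good_record t r -> good_record t' r' ->
  code r = code r' -> same_record r r'.
Proof.
move=> [_ tr _ _] [_ tr' _ _] eqc.
have bnd (r0 : nat * seq (nat * nat)) x : trail x r0.2 ->
  \sum_(e <- unzip1 r0.2) 2 ^ e < 2 ^ m.
  move=> tr0; rewrite (sum_uniq_binary (trail_uniq tr0) (n := m)); last first.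
    by move=> e; exact: trail_lt tr0.
  exact: (binary_lt m (fun e => e \in unzip1 r0.2)).
have b1 := bnd r _ tr; have b2 := bnd r' _ tr'.
have eqj : r.1 = r'.1.
  have := congr1 (divn^~ (2 ^ m)) eqc.
  by rewrite /code !divnMDl ?expn_gt0 // !divn_small // !addn0.
split=> // e; move: eqc; rewrite /code eqj => /addnI.
rewrite !(@sum_uniq_binary m) ?(trail_uniq tr) ?(trail_uniq tr') //; last first.
- by move=> i; exact: trail_lt tr.
- by move=> i; exact: trail_lt tr'.
move=> /binary_inj h; case: (ltnP e m) => [|ge]; first exact: h.
apply/idP/idP => [/(trail_lt tr)|/(trail_lt tr')]; by rewrite ltnNge ge.
Qed.

Lemma same_code t t' r r' : good_record t r -> good_record t' r' ->
  same_record r r' -> code r = code r'.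
Proof.
move=> [_ tr _ _] [_ tr' _ _] [eqj eqw]; rewrite /code eqj; congr (_ + _).
apply: perm_big; apply: uniq_perm => //; apply: trail_uniq; eassumption.
Qed.

(** Completeness is only up to [same_record]: a good record needs a representative in [L], and
    distinct codes make it unique. *)
Definition search_inv t L :=
  [/\ forall r, r \in L -> good_record t r,
      forall r, good_record t r -> exists2 r', r' \in L & same_record r r'
    & uniq (map code L)].

Lemma mem_push L s r : r \in foldl push L s -> r \in L ++ s.
Proof.
elim: s L => [|r0 s IH] L /=; first by rewrite cats0.
move=> /IH; rewrite !mem_cat inE /push; case: ifP => _; last first.
  by rewrite mem_rcons inE -orbA orbCA.
by move=> /orP[->|->]; rewrite ?orbT.
Qed.

Lemma push_code L s r : r \in L ++ s -> code r \in map code (foldl push L s).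
Proof.
elim: s L r => [|r0 s IH] L r /=; first by rewrite cats0; exact: map_f.
rewrite mem_cat inE orbA => /orP[|rs]; last first.
  by apply: IH; rewrite mem_cat rs orbT.
move=> h; have : code r \in map code (push L r0).
  move: h; rewrite /push; case: ifP => h0.
    by case/orP => [/(map_f code)//|/eqP->].
  by rewrite map_rcons mem_rcons inE => /orP[/(map_f code)->|/eqP->];
    rewrite ?orbT ?eqxx.
by case/mapP => r1 h1 ->; apply: IH; rewrite mem_cat h1.
Qed.

Lemma push_uniq L s : uniq (map code L) -> uniq (map code (foldl push L s)).
Proof.
elim: s L => //= r0 s IH L uL; apply: IH; rewrite /push.
by case: ifP => // h; rewrite map_rcons rcons_uniq h.
Qed.

Lemma missing0 t w :
  (missing t w == 0) =
  all (fun e => (last_time e <= t) ==> (e \in unzip1 w)) (active m t).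
Proof.
rewrite /missing -leqn0 leqNgt -has_count; rewrite -all_predC; apply: eq_all => e /=.
by rewrite implybE negb_and negbK orbC.
Qed.

Lemma missing1 t w e : e \in active m t -> e \notin unzip1 w ->
  (missing t w - (last_time e <= t) == 0) =
  all (fun e' => (last_time e' <= t) ==> (e' \in e :: unzip1 w)) (active m t).
Proof.
move=> ea ew; rewrite /missing (permP (perm_to_rem ea)) /= ew /= addKn.
rewrite (perm_all _ (perm_to_rem ea)) /= mem_head implybT /=.
rewrite -leqn0 leqNgt -has_count -all_predC; apply: eq_in_all => e'.
rewrite (mem_rem_uniq e (active_uniq _ _)) inE => /andP[/negbTE ne _] /=.
by rewrite inE ne /= implybE negb_and negbK orbC.
Qed.

Lemma successors_good t r r' :
  good_record t r -> r' \in successors t r -> good_record t.+1 r'.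
Proof.
move=> [lt tr tm dead]; rewrite /successors mem_cat => /orP[].
  case: ifP => // ; rewrite missing0 => /allP h; rewrite inE => /eqP->.
  split=> // [|e em].
    by apply: sub_all tm => t' /ltnW.
  rewrite ltnS leq_eqVlt => /orP[/eqP le|]; last exact: dead.
  by have := h e; rewrite mem_active em -le last_time_in ?nonempty // leqnn => /(_ isT).
move=> /mapP[e]; rewrite mem_filter => /andP[/and3P[new inc mis] act] ->.
move: mis; rewrite (missing1 act new) => /allP h; move: act;
  rewrite mem_active => /andP[em te].
split=> // [||e' e'm].
- by rewrite /= em te new inc tm.
- by rewrite /= ltnSn /=; apply: sub_all tm => t' /ltnW.
rewrite ltnS leq_eqVlt => /orP[/eqP le|lt']; last by rewrite /= inE dead ?orbT.
by have := h e'; rewrite mem_active e'm -le last_time_in ?nonempty // leqnn => /(_ isT).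
Qed.

(** An exchange argument gives completeness: the part of a trail before time [t] is replaced by its
    representative in [L]. That has the same edges and, by parity, the same end, so a step at time
    [t] can follow it just as well. *)
Lemma search_step_inv t L : search_inv t L -> search_inv t.+1 (search_step t L).
Proof.
move=> [sound compl uL].
have sound' r : r \in flatten (map (successors t) L) -> good_record t.+1 r.
  by move=> /flatten_mapP[r0 /sound g0]; exact: successors_good.
split=> [r|r gr|]; last exact: push_uniq.
  by move=> /mem_push; exact: sound'.
suff [r1 h1 s1] : exists2 r1, r1 \in flatten (map (successors t) L) & same_record r r1.
  have /mapP[r2 h2 c2] := push_code (L := [::]) h1.
  exists r2 => //; apply: (code_inj gr (sound' _ (mem_push h2))).
  by rewrite -c2; exact: same_code gr (sound' _ h1) s1.
case: r gr => j w [/= jlt tr tm dead].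
(* The step at time [t] is cut off, if there is one. Its edge is active at [t], hence does not end
   before [t], and the shorter trail is still good at [t]. *)
pose w0 := if w is et :: w' then (if et.2 == t then w' else w) else w.
have g0 : good_record t (j, w0).
  rewrite /w0; case: w tr tm dead {w0} => [|[e te] w] /= tr.
    by move=> _ dead; split=> // e em /ltnW; exact: dead.
  have /and5P[/= em et inc new /andP[old tr']] := tr => /andP[lt tm] dead.
  case: eqP => /= [eqt|ne]; split=> //=.
  - by apply: sub_all old => t'; rewrite eqt.
  - move=> e' e'm lt'; have := dead e' e'm (ltnW lt'); rewrite inE => /orP[/eqP eqe|//].
    by have := last_time_ge et; move: lt'; rewrite eqe eqt ltnNge => /negbTE->.
  - have tet : te < t by rewrite ltn_neqAle; move/eqP: ne => ->.
    by rewrite tet; apply: sub_all old => t' /ltn_trans; exact.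
  - by move=> e' e'm /ltnW; exact: dead.
have [[j' w1] in1 [/= eqj same1]] := compl _ g0; subst j'.
have [_ tr1 tm1 dead1] := sound _ in1; have [_ tr0 tm0 dead0] := g0.
have eqv : endpoint (origin (j, w0)) w0 = endpoint (origin (j, w1)) w1.
  exact: endpoint_perm.
suff [w2 h2 same2] : exists2 w2, (j, w2) \in successors t (j, w1) &
  unzip1 w =i unzip1 w2.
  exists (j, w2); last by split.
  by apply/flatten_mapP; exists (j, w1).
(* If [w] does not use time [t], the representative itself is kept: nothing is missing, since [w]
   already contains all edges that end by [t]. Otherwise the step at [t] is appended to the
   representative. *)
case: (boolP (all (fun t' => t' < t) (unzip2 w))) => [tm'|].
  have eqw : w0 = w.
    by rewrite /w0; case: (w) tm' => //= et w' /andP[/ltn_eqF->].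
  exists w1; last by rewrite -eqw.
  rewrite /successors mem_cat missing0; apply/orP; left.
  case: ifP; rewrite ?inE ?eqxx // => /negbT/allPn[e];
    rewrite mem_active => /andP[em _].
  rewrite negb_imply => /andP[le]; rewrite -same1 eqw => /negP[].
  by apply: dead => //; rewrite ltnS.
case: w tr tm dead @w0 g0 same1 tr0 tm0 dead0 eqv => [|[e te] w] //= tr.
have /and5P[/= em et inc new /andP[old tr']] := tr => /andP[lt tm] dead.
case: eqP => [eqt _ same1 _ _ _ eqv _|ne]; last first.
  move=> _ _ _ _ _ _; rewrite negb_and => /orP[].
    by rewrite -leqNgt => ge; case: ne; apply/eqP; rewrite eqn_leq ge -ltnS lt.
  case/negP; have tet : te < t by rewrite ltn_neqAle; move/eqP: ne => ->.
  by apply: sub_all old => t' /ltn_trans; exact.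
exists ((e, t) :: w1); last by move=> e'; rewrite /= !inE same1.
have act : e \in active m t by rewrite mem_active em -eqt.
have new1 : e \notin unzip1 w1 by rewrite -same1.
rewrite /successors mem_cat; apply/orP; right; apply/mapP; exists e => //.
rewrite mem_filter act andbT; apply/and3P; split=> //=.
  by rewrite -eqv.
rewrite missing1 //; apply/allP => e'; rewrite mem_active => /andP[e'm _].
apply/implyP => le; have := dead e' e'm; rewrite ltnS => /(_ le).
by rewrite !inE same1.
Qed.

(* A record at time [t] is determined by its start and by which of the edges
   whose span contains [t] it uses. *)
Lemma search_size t L : search_inv t L -> size L <= size starts * 2 ^ coverage m t.
Proof.
move=> [sound _ uL].
pose A := [seq i <- iota 0 m | first i <= t <= last_time i].
have szA : size A = coverage m t by rewrite coverE size_filter.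
pose key (r : nat * seq (nat * nat)) := (r.1, [seq e \in unzip1 r.2 | e <- A]).
pose keys := [seq (j, val b) | j <- iota 0 (size starts),
                               b <- enum {: (size A).-tuple bool}].
have -> : size starts * 2 ^ coverage m t = size keys.
  by rewrite size_allpairs size_iota -cardE card_tuple card_bool szA.
rewrite -(size_map key L); apply: uniq_leq_size.
  rewrite map_inj_in_uniq ?(map_uniq uL) // => r r' rL r'L [eqj /eq_in_map eqb].
  have gr := sound _ rL; have gr' := sound _ r'L.
  apply: (uniq_map_inj uL rL r'L); apply: (same_code gr gr'); split=> // e.
  have [_ tr tm dead] := gr; have [_ tr' tm' dead'] := gr'.
  case: (ltnP e m) => [em|ge]; last first.
    by apply/idP/idP => [/(trail_lt tr)|/(trail_lt tr')]; rewrite ltnNge ge.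
  case: (ltnP (last_time e) t) => [lt|ge]; first by rewrite dead ?dead'.
  case: (leqP (first e) t) => [le|gt].
    by apply: eqb; rewrite mem_filter le ge mem_iota.
  have late x (w : seq (nat * nat)) :
    trail x w -> all (fun t' => t' < t) (unzip2 w) -> e \notin unzip1 w.
    move=> trw /allP tmw; apply/negP => /mapP[et inw ee].
    have := first_le (trail_times trw inw); rewrite -ee leqNgt => /negP[].
    by apply: ltn_trans gt; apply: tmw; exact: map_f.
  by rewrite (negbTE (late _ _ tr tm)) (negbTE (late _ _ tr' tm')).
move=> k /mapP[r /sound [lt _ _ _] ->].
have sz : size [seq e \in unzip1 r.2 | e <- A] == size A by rewrite size_map.
apply/allpairsP; exists (r.1, Tuple sz); split=> //; first by rewrite mem_iota.
by rewrite mem_enum.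
Qed.

Fixpoint search t : seq (nat * seq (nat * nat)) :=
  if t is t'.+1 then search_step t' (search t')
  else [seq (j, [::]) | j <- iota 0 (size starts)].

Lemma searchP t : search_inv t (search t).
Proof.
elim: t => [|t IH]; last exact: search_step_inv.
split=> /=.
- by move=> r /mapP[j]; rewrite mem_iota => jlt ->; split.
- case=> j [|[e t] w] [/= jlt tr tm dead] //.
  by exists (j, [::]) => //; apply/mapP; exists j; rewrite ?mem_iota.
- rewrite -map_comp map_inj_uniq ?iota_uniq // => j j' /=.
  by rewrite /code /= !big_nil !addn0 => /eqP; rewrite eqn_pmul2r ?expn_gt0 // => /eqP.
Qed.

End Search.

(** * Candidate starts and correctness of the search *)

Definition eulerian_trail x w := [/\ trail x w, size w = m & endpoint x w = x].

(* The first edge of a covering trail starts no later than any edge ends. *)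
Fixpoint min_last n : nat :=
  if n is n'.+1 then minn (min_last n') (last_time n') else last_time 0.

Fixpoint candidates M n : seq nat :=
  if n is n'.+1 then
    candidates M n' ++ (if first n' <= M then [:: end1 n'; end2 n'] else [::])
  else [::].

Lemma min_last_le n i : i < n -> min_last n <= last_time i.
Proof.
elim: n => //= n IH; rewrite ltnS leq_eqVlt => /orP[/eqP->|/IH h]; lia.
Qed.

Lemma le_min_last n M :
  0 < n -> (forall i, i < n -> M <= last_time i) -> M <= min_last n.
Proof.
case: n => // n _ h; have: M <= min_last 0 by exact: h.
elim: n.+1 h => //= {}n IH h h0; rewrite leq_min h // IH // => i lt.
by apply: h; exact: ltnW.
Qed.

Lemma mem_candidates M n e x :
  e < n -> first e <= M -> incident e x -> x \in candidates M n.
Proof.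
elim: n => //= n IH; rewrite ltnS leq_eqVlt mem_cat => /orP[/eqP-> -> | lt fe inc].
  by rewrite /incident !inE => ->; rewrite orbT.
by rewrite IH.
Qed.

(** No edge ends before [min_last N], so an edge that starts by then straddles that time; each such
    edge contributes its two ends. *)
Lemma size_candidates n N : n <= N -> 
  size (candidates (min_last N) n) <= (coverage n (min_last N)).*2.
Proof.
elim: n => //= n IH lt; rewrite size_cat doubleD leq_add ?IH //; first exact: ltnW.
by rewrite (min_last_le lt) andbT; case: ifP.
Qed.

(** At the horizon every edge has ended, so a good record contains all of them. Closedness may be
    tested on the stored representative, because trails with the same start and the same edges end
    at the same vertex. *)
Lemma search_correct :
  0 < m -> (forall i, i < m -> end1 i != end2 i) ->
  (forall i, i < m -> times i != [::]) ->
  let starts := candidates (min_last m) m in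
  (exists x w, eulerian_trail x w) <->
  exists2 r, r \in search starts (horizon m) &
    origin starts r = endpoint (origin starts r) r.2.
Proof.
move=> m0 loopless nonempty starts.
have [sound compl _] := searchP loopless nonempty starts (horizon m).
split; last first.
  case=> r /sound [jlt tr _ dead] closed; exists (origin starts r), r.2.
  split=> //; apply/eqP; rewrite eqn_leq -(size_map fst) -[m](size_iota 0).
  rewrite !uniq_leq_size ?iota_uniq ?(trail_uniq tr) //.
    by move=> e; rewrite mem_iota => /= em; apply: dead => //; exact: lt_horizon.
  by move=> e /(trail_lt tr); rewrite mem_iota.
case=> x [w [tr sz closed]].
have xs : x \in starts.
  have: w != [::] by rewrite -size_eq0 sz -lt0n.
  (* The first step taken is the last of the list. The [first] of its edge is at most every time
     used, and every edge is used no later than its last time. *)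
  case/lastP: w tr sz closed => // w [e t] tr sz _ _.
  have [em inc fe] : [/\ e < m, incident e x & forall et, et \in rcons w (e, t) ->
    first e <= et.2].
    elim: w tr {sz} => [|et w IH] /=.
      move=> /and4P[em te inc _]; split=> // et; rewrite inE => /eqP->.
      exact: first_le.
    move=> /and5P[_ _ _ _ /andP[/allP old /IH[em inc fe]]]; split=> // et'.
    rewrite inE => /orP[/eqP->|]; last exact: fe.
    apply: leq_trans (fe (e, t) _) (ltnW (old _ _));
      first by rewrite mem_rcons mem_head.
    by apply/mapP; exists (e, t); rewrite // mem_rcons mem_head.
  apply: mem_candidates em _ inc; apply: le_min_last => // i im.
  have: i \in unzip1 (rcons w (e, t)) by rewrite (perm_mem (trail_perm tr sz)) mem_iota.
  case/mapP => et inw ->; apply: leq_trans (fe _ inw) _.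
  exact: last_time_ge (trail_times tr inw).
pose r := (index x starts, w).
have ox : origin starts r = x by rewrite /origin nth_index.
have gr : good_record starts (horizon m) r.
  split; rewrite ?ox ?index_mem //=.
    apply/allP => t /mapP[et inw ->].
    apply: leq_ltn_trans (last_time_ge (trail_times tr inw)) (lt_horizon _).
    by apply: trail_lt tr _; exact: map_f.
  by move=> e em _; rewrite (perm_mem (trail_perm tr sz)) mem_iota.
have [r' inr [eqj eqw]] := compl _ gr; exists r' => //.
have [_ tr' _ _] := sound _ inr.
have ox' : origin starts r' = x by rewrite -ox /origin eqj.
rewrite ox' in tr' *; rewrite -[LHS]closed; exact: endpoint_perm eqw.
Qed.

End Instance.

(** * From temporal graphs to numbered edges *)

Section Encoding.

Variables (V : finType) (G : temporal_graph V).
Variables (num : V -> nat) (rs : seq (V * V * seq nat)).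

Hypothesis num_inj : injective num.
Hypothesis rs_edges :
  perm_eq [seq [set r.1.1; r.1.2] | r <- rs] (enum (tg_edges G)).
Hypothesis rs_times :
  forall r, r \in rs -> perm_eq r.2 (tg_times G [set r.1.1; r.1.2]).

Definition instance_of : seq (nat * nat * seq nat) :=
  [seq (num r.1.1, num r.1.2, r.2) | r <- rs].

Local Notation es := instance_of.
Local Notation edge_sets := [seq [set r.1.1; r.1.2] | r <- rs].

Lemma size_instance : size es = size rs.
Proof. exact: size_map. Qed.

Lemma edge_sets_uniq : uniq edge_sets.
Proof. by rewrite (perm_uniq rs_edges) enum_uniq. Qed.

Lemma mem_edge_sets e : (e \in edge_sets) = (e \in tg_edges G).
Proof. by rewrite (perm_mem rs_edges) mem_enum. Qed.

Lemma instance_edge i : i < size rs -> exists a b,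
  [/\ end1 es i = num a, end2 es i = num b, nth set0 edge_sets i = [set a; b],
      perm_eq (times es i) (tg_times G [set a; b]) & [set a; b] \in tg_edges G].
Proof.
move=> lt; have [r0 _] : exists r0, r0 \in rs by case: rs lt => // r; exists r;
  exact: mem_head.
have inr := mem_nth r0 lt; set r := nth r0 rs i in inr.
exists r.1.1, r.1.2; split.
- by rewrite /end1 /edge (nth_map r0).
- by rewrite /end2 /edge (nth_map r0).
- by rewrite (nth_map r0).
- by rewrite /times /edge (nth_map r0) //=; exact: rs_times.
- by rewrite -mem_edge_sets; apply/mapP; exists r.
Qed.

Lemma instance_loopless i : i < size es -> end1 es i != end2 es i.
Proof.
rewrite size_instance => /instance_edge[a [b [-> -> _ _ inE]]].
have := tg_simple inE; rewrite cards2 => h.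
by apply/eqP => /num_inj eqab; rewrite eqab eqxx in h.
Qed.

Lemma walk_rcons x es1 e y :
  walk G x (rcons es1 e) y <->
  exists z, [/\ walk G x es1 z, e \in tg_edges G & e = [set z; y]].
Proof.
elim: es1 x => [|e1 es1 IH] x /=; split.
- by case=> eE [z ez <-]; exists x; split.
- by case=> z [<- eE ez]; split=> //; exists y.
- case=> e1E [z ez /IH[z' [w eE e']]]; exists z'; split=> //; split=> //.
  by exists z.
- case=> z [[e1E [z1 e1z w]] eE ez]; split=> //; exists z1 => //.
  by apply/IH; exists z.
Qed.

Lemma walk_edges x es1 y e : walk G x es1 y -> e \in es1 -> e \in tg_edges G.
Proof.
elim: es1 x => //= e1 es1 IH x [e1E [z _ w]]; rewrite inE => /orP[/eqP->//|].
exact: IH w.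
Qed.

Lemma trail_of_walk x y w : temporal_walk G x y w -> uniq (unzip1 w) ->
  let w' := rev [seq (index et.1 edge_sets, et.2) | et <- w] in
  trail es (num x) w' /\ endpoint es (num x) w' = num y.
Proof.
elim/last_ind: w y => [|w [e t] IH] y [wk tm st] un /=; first by rewrite wk.
move: wk; rewrite /unzip1 map_rcons /= => /walk_rcons[z [wk eE ez]].
rewrite map_rcons rev_rcons /=.
have [] := IH z.
- split=> // [et inw|].
    by apply: tm; rewrite mem_rcons inE inw orbT.
  move: st; rewrite /unzip2 map_rcons -cats1 => /cat_sorted2[]; exact.
- by move: un; rewrite /unzip1 map_rcons rcons_uniq => /andP[].
set w' := rev _ => tr ev.
have eS : e \in edge_sets by rewrite mem_edge_sets.
have lt : index e edge_sets < size rs by rewrite -(size_map (fun r => [set r.1.1;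
  r.1.2])) index_mem.
have [a [b [Ea Eb Eab Et _]]] := instance_edge lt.
have eab : e = [set a; b] by rewrite -Eab nth_index.
rewrite ev; split.
  apply/and5P; split; first by rewrite size_instance.
  - rewrite (perm_mem Et) -eab; apply: (tm (e, t)).
    by rewrite mem_rcons mem_head.
  - have: z \in [set a; b] by rewrite -eab ez !inE eqxx.
    by rewrite !inE /incident Ea Eb => /orP[]/eqP->; rewrite eqxx ?orbT.
  - apply/negP; rewrite /w' /unzip1 map_rev mem_rev -map_comp => /mapP[et inw /= eqi].
    have etE : et.1 \in edge_sets.
      by rewrite mem_edge_sets; apply: walk_edges wk _; exact: map_f.
    have eqe : e = et.1 by rewrite -(nth_index set0 eS) eqi nth_index.
    by move: un; rewrite /unzip1 map_rcons rcons_uniq eqe (map_f fst inw).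
  - rewrite tr andbT; apply/allP => t'; rewrite /w' /unzip2 map_rev mem_rev -map_comp
      => int.
    move: st; rewrite /unzip2 map_rcons (sorted_pairwise ltn_trans) pairwise_rcons.
    by move=> /andP[/allP/(_ t')-> //].
have ne : a != b.
  by have := instance_loopless; move/(_ (index e edge_sets));
    rewrite size_instance Ea Eb => /(_ lt); apply: contra => /eqP->.
have: z \in [set a; b] by rewrite -eab ez !inE eqxx.
have: y \in [set a; b] by rewrite -eab ez !inE eqxx orbT.
have zy : z != y.
  have := tg_simple eE; rewrite ez cards2 => h; apply/eqP => eqzy.
  by rewrite eqzy eqxx in h.
rewrite /opposite Ea Eb !inE => /orP[]/eqP eqy /orP[]/eqP eqz;
  rewrite eqy eqz ?addKn ?addnK //; by rewrite eqy eqz eqxx in zy.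
Qed.

Lemma walk_of_trail x w : trail es (num x) w ->
  let w' := rev [seq (nth set0 edge_sets et.1, et.2) | et <- w] in
  exists2 y, temporal_walk G x y w' & endpoint es (num x) w = num y.
Proof.
elim: w => [|[e t] w IH] /=; first by exists x.
move=> /and5P[em te inc new /andP[old /IH[z [wk tm st] ev]]].
rewrite size_instance in em.
have [a [b [Ea Eb Eab Et abE]]] := instance_edge em.
have [y ey oy] : exists2 y, [set a; b] = [set z; y] & opposite es e (num z) = num y.
  move: inc; rewrite ev /incident /opposite Ea Eb => /orP[]/eqP/num_inj->.
    by exists b; rewrite ?addKn.
  by exists a; rewrite ?addnK // setUC.
exists y; last by rewrite ev.
rewrite rev_cons; split.
- rewrite /unzip1 map_rcons; apply/walk_rcons; exists z; split=> //=; by rewrite Eab.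
- move=> et; rewrite mem_rcons inE => /orP[/eqP->/=|]; last exact: tm.
  by rewrite Eab -(perm_mem Et).
- rewrite /unzip2 map_rcons (sorted_pairwise ltn_trans) pairwise_rcons.
  rewrite -(sorted_pairwise ltn_trans) st andbT; apply/allP => t'.
  by rewrite map_rev mem_rev -map_comp => int; apply: (allP old).
Qed.

(** Without edges the equivalence can fail: the empty list is a trail from any number, whereas a
    circuit needs a vertex of [V]. *)
Lemma temporally_eulerianE : 0 < size rs ->
  temporally_eulerian G <-> exists x w, eulerian_trail es x w.
Proof.
move=> rs0; split.
  case=> w [[x tw] [_ cnt]]; have [wk tm st] := tw.
  have pe : perm_eq (unzip1 w) edge_sets.
    apply/allP => e; rewrite mem_cat /= => h.
    have eE : e \in tg_edges G.
      by case/orP: h => [/(walk_edges wk)|]; rewrite ?mem_edge_sets.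
    by rewrite cnt // count_uniq_mem ?edge_sets_uniq // mem_edge_sets eE.
  have un : uniq (unzip1 w) by rewrite (perm_uniq pe) edge_sets_uniq.
  have [tr ev] := trail_of_walk tw un.
  exists (num x), (rev [seq (index et.1 edge_sets, et.2) | et <- w]); split=> //.
  by rewrite size_rev size_map size_instance -(size_map fst) (perm_size pe) size_map.
case=> x [w [tr sz ev]].
(* A number need not be a vertex; [x] is one because it is incident with the first edge taken. *)
have [X xX] : exists X, x = num X.
  case/lastP: w tr sz ev => [|w [e t]] tr; first by rewrite size_instance /= => sz;
    rewrite -sz in rs0.
  move=> _ _; elim: w tr => [|et w IH] /=; last by move=> /and5P[_ _ _ _ /andP[_ /IH]].
  rewrite size_instance => /and4P[/instance_edge[a [b [Ea Eb _ _ _]]] _].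
  by rewrite /incident Ea Eb => /orP[]/eqP->; [exists a | exists b].
rewrite {}xX in tr ev; have [y tw] := walk_of_trail tr.
rewrite ev => /num_inj eqy; rewrite -{y}eqy in tw.
exists (rev [seq (nth set0 edge_sets et.1, et.2) | et <- w]); split; first by exists X.
split; first by exists X; case: tw.
move=> e eE; rewrite /unzip1 map_rev count_rev -map_comp.
have -> : [seq (fst \o (fun et => (nth set0 edge_sets et.1, et.2))) i | i <- w] =
  map (nth set0 edge_sets) (unzip1 w) by rewrite -map_comp.
have pe := perm_map (nth set0 edge_sets) (trail_perm tr sz).
rewrite (permP pe) size_instance -(size_map (fun r => [set r.1.1; r.1.2])).
rewrite -/(mkseq _ _) mkseq_nth count_uniq_mem ?edge_sets_uniq // mem_edge_sets eE //.
Qed.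

(** The gaps telescope: [y - x] is at most [u] times the number of elements of [T] in the interval
    from [x], excluded, to [y], included, and [T] has at most [k] elements. *)
Lemma times_span k u i : temp_euler_instance G k -> consecutive_gaps_at_most G u ->
  i < size es -> last_time es i - first es i <= k * u.
Proof.
rewrite size_instance => hk hu /instance_edge[a [b [_ _ _ pt eE]]].
case: (eqVneq (times es i) [::]) => [t0|ne].
  by rewrite /last_time t0 /=.
set T := tg_times G [set a; b] in pt.
have gap x y : x \in T -> y \in T -> x <= y ->
  y - x <= count (fun z => x < z <= y) T * u.
  move: {2}(y - x) (leqnn (y - x)) => n; elim: n x => [|n IH] x le xT yT xy;
    first by lia.
  case: (eqVneq x y) => [->|nxy]; first by rewrite subnn.
  have ex : exists z, (z \in T) && (x < z) by exists y; rewrite yT ltn_neqAle nxy.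
  (* [z] is the least time after [x], hence consecutive to it. *)
  have [z /andP[zT xz] zmin] := ex_minnP ex.
  have zy : z <= y by apply: zmin; rewrite yT ltn_neqAle nxy.
  have gz : z - x <= u.
    apply: (hu _ eE); split=> // s sT; apply/negP => /andP[xs sz].
    by have := zmin s; rewrite sT xs => /(_ isT); rewrite leqNgt sz.
  have yz : y - z <= count (fun v => z < v <= y) T * u by apply: IH => //; lia.
  have : 1 + count (fun v => z < v <= y) T <= count (fun v => x < v <= y) T.
    have -> : 1 = count (pred1 z) T by rewrite count_uniq_mem ?fset_uniq // zT.
    rewrite -count_predUI addnC.
    have -> : count (predI (pred1 z) (fun v => z < v <= y)) T = 0.
      by rewrite (eq_count (a2 := pred0)) ?count_pred0 // => v /=;
        case: eqP => // ->; rewrite ltnn.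
    rewrite add0n; apply: sub_count => v /= /orP[/eqP->|/andP[zv ->]];
      first by rewrite xz.
    by rewrite (ltn_trans xz).
  by move=> /(leq_mul (leqnn u)); rewrite mulnDr muln1 ![u * _]mulnC; lia.
have fT : first es i \in T by rewrite -(perm_mem pt) first_in.
have lT : last_time es i \in T by rewrite -(perm_mem pt) last_time_in.
apply: leq_trans (gap _ _ fT lT _) _.
  by apply: first_le; rewrite (perm_mem pt).
rewrite leq_mul2r; apply/orP; right; apply: leq_trans (count_size _ _) _; exact: hk.
Qed.

Lemma last_time_le_lifetime i : i < size es -> last_time es i <= lifetime G.
Proof.
rewrite size_instance => /instance_edge[a [b [_ _ _ pt eE]]].
case: (eqVneq (times es i) [::]) => [t0|ne]; first by rewrite /last_time t0.
have lT : last_time es i \in tg_times G [set a;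
  b] by rewrite -(perm_mem pt) last_time_in.
apply: leq_trans (leq_bigmax_cond [set a; b] eE).
by rewrite (leq_bigmax_seq _ lT).
Qed.

Lemma times_uniq i : i < size es -> uniq (times es i).
Proof.
by rewrite size_instance => /instance_edge[a [b [_ _ _ pt eE]]];
  rewrite (perm_uniq pt) fset_uniq.
Qed.

End Encoding.

(** * The program *)

Local Notation "p ;; q" := (Seq p q) (at level 60, right associativity).

Local Notation res := 0 (only parsing).
Local Notation nedges := 1 (only parsing).
Local Notation cur := 2 (only parsing).
Local Notation pos := 3 (only parsing).
Local Notation left := 4 (only parsing).
Local Notation lofirst := 5 (only parsing).
Local Notation hilast := 6 (only parsing).
Local Notation span := 7 (only parsing).
Local Notation hor := 8 (only parsing).
Local Notation weight := 9 (only parsing).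
Local Notation bad := 10 (only parsing).
Local Notation now := 11 (only parsing).
Local Notation tmp := 12 (only parsing).
Local Notation minlast := 13 (only parsing).
Local Notation base := 14 (only parsing).
Local Notation lo := 15 (only parsing).
Local Notation hi := 16 (only parsing).
Local Notation top := 17 (only parsing).
Local Notation miss := 18 (only parsing).
Local Notation ptr := 19 (only parsing).
Local Notation edg := 20 (only parsing).
Local Notation anc := 21 (only parsing).
Local Notation found := 22 (only parsing).
Local Notation ncode := 23 (only parsing).
Local Notation nvtx := 24 (only parsing).
Local Notation nstamp := 25 (only parsing).
Local Notation nvia := 26 (only parsing).
Local Notation npar := 27 (only parsing).

(* The edges active at a time [t] form a linked list from [aHead]; its pointers
   are the positions in the input at which [t] is listed. *)
Local Notation aInput := 0 (only parsing).
Local Notation aEnd1 := 1 (only parsing).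
Local Notation aEnd2 := 2 (only parsing).
Local Notation aFirst := 3 (only parsing).
Local Notation aLast := 4 (only parsing).
Local Notation aWeight := 5 (only parsing).
Local Notation aCover := 6 (only parsing).
Local Notation aHead := 7 (only parsing).
Local Notation aNext := 8 (only parsing).
Local Notation aEdge := 9 (only parsing).
Local Notation aOrigin := 10 (only parsing).
Local Notation aVertex := 11 (only parsing).
Local Notation aCode := 12 (only parsing).
Local Notation aStamp := 13 (only parsing).
Local Notation aVia := 14 (only parsing).
Local Notation aParent := 15 (only parsing).
Local Notation aSeen := 16 (only parsing).

(* Nonzero exactly when the two values differ. *)
Definition Diff a b := Add (Sub a b) (Sub b a).

(* The minimum, hence nonzero exactly when both values are. *)
Definition Both a b := Sub a (Sub a b).

Definition Incr x := Assign x (Add (Reg x) (Const 1)).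

Definition find_step :=
  If (Diff (Read aVia (Reg anc)) (Reg edg)) Skip (Assign found (Const 1)) ;;
  Assign anc (Read aParent (Reg anc)).

(* The stamp of a record is the time of its last edge plus one, and zero for the
   empty trail; so the ancestors used before [edg] first appears are skipped. *)
Definition find_loop :=
  While (Sub (Read aStamp (Reg anc)) (Read aFirst (Reg edg))) find_step.

Definition find :=
  (Assign anc (Reg lo) ;; Assign found (Const 0)) ;; find_loop.

(** Entries of [aSeen] left by earlier times are below [now + 1], so the table, which may have
    exponentially many cells in the number of edges, is never cleared. *)
Definition append_record :=
  Write aSeen (Reg ncode) (Add (Reg now) (Const 1)) ;;
  Write aOrigin (Reg top) (Read aOrigin (Reg lo)) ;;
  Write aVertex (Reg top) (Reg nvtx) ;;
  Write aCode (Reg top) (Reg ncode) ;;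
  Write aStamp (Reg top) (Reg nstamp) ;;
  Write aVia (Reg top) (Reg nvia) ;;
  Write aParent (Reg top) (Reg npar) ;;
  Incr top.

Definition push_record :=
  If (Diff (Read aSeen (Reg ncode)) (Add (Reg now) (Const 1))) append_record Skip.

Definition missing_step :=
  Assign edg (Read aEdge (Reg ptr)) ;;
  find ;;
  (If (Add (Reg found) (Sub (Read aLast (Reg edg)) (Reg now))) Skip (Incr miss) ;;
   Assign ptr (Read aNext (Reg ptr))).

Definition count_missing :=
  (Assign miss (Const 0) ;; Assign ptr (Read aHead (Reg now))) ;;
  While (Reg ptr) missing_step.

(** The last step is copied, and the new record does not point to the old one. Every link thus
    stands for a real step, and idle times do not lengthen the backward search. *)
Definition keep_copy :=
  Assign ncode (Read aCode (Reg lo)) ;;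
  Assign nvtx (Read aVertex (Reg lo)) ;;
  Assign nstamp (Read aStamp (Reg lo)) ;;
  Assign nvia (Read aVia (Reg lo)) ;;
  Assign npar (Read aParent (Reg lo)).

Definition keep := If (Reg miss) Skip (keep_copy ;; push_record).

Definition extend_copy :=
  Assign ncode (Add (Read aCode (Reg lo)) (Read aWeight (Reg edg))) ;;
  Assign nvtx (Sub (Add (Read aEnd1 (Reg edg)) (Read aEnd2 (Reg edg)))
                   (Read aVertex (Reg lo))) ;;
  Assign nstamp (Add (Reg now) (Const 1)) ;;
  Assign nvia (Reg edg) ;;
  Assign npar (Reg lo).

(** Zero means that extending is allowed: a sum is zero when all terms are, [Both] when one of them
    is. The innermost [Sub] from 1 is the indicator of [last_time e <= t]. *)
Definition cannot_extend :=
  Add (Reg found)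
    (Add (Sub (Reg miss) (Sub (Const 1) (Sub (Read aLast (Reg edg)) (Reg now))))
         (Both (Diff (Read aVertex (Reg lo)) (Read aEnd1 (Reg edg)))
               (Diff (Read aVertex (Reg lo)) (Read aEnd2 (Reg edg))))).

Definition extend_step :=
  Assign edg (Read aEdge (Reg ptr)) ;;
  find ;;
  If cannot_extend Skip (extend_copy ;; push_record) ;;
  Assign ptr (Read aNext (Reg ptr)).

Definition extend :=
  Assign ptr (Read aHead (Reg now)) ;; While (Reg ptr) extend_step.

Definition process_record := count_missing ;; keep ;; extend ;; Incr lo.

(** The records form a queue: those from [lo] to [hi] belong to the current time, those from [hi] to
    [top] to the next. Older ones stay in place, as parents refer to them. *)
Definition time_step :=
  While (Sub (Reg hi) (Reg lo)) process_record ;;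
  (Assign hi (Reg top) ;; Incr now).

Definition sweep :=
  (Assign lo (Const 0) ;; Assign hi (Reg top) ;; Assign now (Const 0)) ;;
  While (Sub (Reg hor) (Reg now)) time_step.

Definition accept :=
  While (Sub (Reg top) (Reg lo))
    (If (Diff (Read aOrigin (Reg lo)) (Read aVertex (Reg lo)))
       Skip (Assign res (Const 1)) ;;
     Incr lo).

(** Parents have smaller indices, so writing a new record at [top] cannot disturb a stored trail. *)
Fixpoint chain (stamp via parent : nat -> nat) q (w : seq (nat * nat)) : Prop :=
  if w is et :: w' then
    [/\ stamp q = et.2.+1, via q = et.1, parent q < q
      & chain stamp via parent (parent q) w']
  else stamp q = 0.

Lemma eq_chain st via par st' via' par' q w :
  (forall p, p <= q -> [/\ st' p = st p, via' p = via p & par' p = par p]) ->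
  chain st via par q w -> chain st' via' par' q w.
Proof.
elim: w q => [|et w IH] q h /=; have [h1 h2 h3] := h q (leqnn q); rewrite h1 ?h2 ?h3 //.
case=> -> -> lt ch; split=> //; apply: IH ch => p le; apply: h.
by rewrite (leq_trans le) // ltnW.
Qed.

(** The null pointer is 0, which is free because no time is listed at position 0 of the input.
    Pointers decrease, so that a new cell leaves the older lists intact. *)
Fixpoint bucket (next edg : nat -> nat) h (l : seq nat) : Prop :=
  if l is e :: l' then
    [/\ 0 < h, edg h = e, next h < h & bucket next edg (next h) l']
  else h = 0.

Lemma eq_bucket nx ed nx' ed' h l :
  (forall p, p <= h -> nx' p = nx p /\ ed' p = ed p) ->
  bucket nx ed h l -> bucket nx' ed' h l.
Proof.
elim: l h => [|e l IH] h hyp //= [h0]; have [-> ->] := hyp h (leqnn h).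
move=> -> lt b; split=> //; apply: IH b => p le; apply: hyp.
by rewrite (leq_trans le) // ltnW.
Qed.

Lemma subn_eqP a b : ((a - b) + (b - a) == 0) = (a == b).
Proof. by apply/eqP/eqP; lia. Qed.

(** * Correctness and running time of the sweep *)

Section Sweep.

Variable es : seq (nat * nat * seq nat).
Variable starts : seq nat.
Variable D : nat.

Local Notation m := (size es).
Local Notation origin := (origin starts).
Local Notation code := (code es).

Hypothesis span_le : forall i, i < m -> last_time es i - first es i <= D.
Hypothesis cover_le : forall t, coverage es m t <= D.*2.+1.

Definition loaded_upto n s :=
  (forall i, i < n ->
    [/\ arr s aEnd1 i = end1 es i, arr s aEnd2 i = end2 es i,
        arr s aFirst i = first es i, arr s aLast i = last_time es i
      & arr s aWeight i = 2 ^ i]) /\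
  (forall t, bucket (arr s aNext) (arr s aEdge) (arr s aHead t) (active es n t)).

Local Notation loaded := (loaded_upto m).

(** The arrays below 10 describe the instance. The sweep writes only to 10 up to 15, which hold the
    records, and to 16, the table of codes. *)
Lemma eq_loaded s s' : (forall a i, a < 10 -> arr s' a i = arr s a i) ->
  loaded s -> loaded s'.
Proof.
move=> eqa [ld bk]; split=> [i im|t].
  by have [h1 h2 h3 h4 h5] := ld i im; split; rewrite eqa.
rewrite eqa //; apply: eq_bucket (bk t) => p _; by split; rewrite eqa.
Qed.

Definition record_at s q (r : nat * seq (nat * nat)) :=
  [/\ arr s aOrigin q = origin r, arr s aVertex q = endpoint es (origin r) r.2,
      arr s aCode q = code r
    & chain (arr s aStamp) (arr s aVia) (arr s aParent) q r.2].

Lemma eq_record_at s s' q r :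
  (forall a p, 10 <= a < 16 -> p <= q -> arr s' a p = arr s a p) ->
  record_at s q r -> record_at s' q r.
Proof.
move=> eqa [h1 h2 h3 h4]; split; rewrite ?eqa //.
by apply: eq_chain h4 => p le; split; rewrite eqa.
Qed.

(** Justifies stopping the backward search: once the latest remaining time is below [first es e],
    the edge cannot occur any more. *)
Lemma trail_head_time x w e :
  trail es x w -> e \in unzip1 w -> first es e <= (head (0, 0) w).2.
Proof.
case: w => // et w tr ew; have /mapP[et' inw ee] := ew.
have fe := first_le (trail_times tr inw); rewrite -ee in fe.
apply: leq_trans fe _; move: inw; rewrite inE => /orP[/eqP->//|inw].
by move: tr => /= /and5P[_ _ _ _ /andP[/allP h _]]; apply/ltnW/h/map_f.
Qed.

(** Stamps strictly decrease along parents, because times do along a trail; so the distance from the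
    initial stamp to [first es e] bounds the number of iterations. *)
Lemma runs_find s x w e n :
  loaded s -> reg s edg = e -> e < m -> trail es x w ->
  chain (arr s aStamp) (arr s aVia) (arr s aParent) (reg s lo) w ->
  arr s aStamp (reg s lo) - first es e <= n ->
  runs find s (22 * n + 10) (fun s' => reg s' found = (e \in unzip1 w)).
Proof.
move=> [ld _] ee em tr ch len; have [_ _ Fe _ _] := ld e em.
apply: (runs_seq_lf (T2 := n * 22 + 6)) => // [|s1 fr1 ->]; first by rewrite /=; lia.
set s2 := run_lf _ _.
pose I k s' := exists2 w', chain (arr s aStamp) (arr s aVia) (arr s aParent) (reg s'
  anc) w' &
  [/\ trail es x w', reg s' found <= 1,
    (e \in unzip1 w) = (reg s' found != 0) || (e \in unzip1 w') &
    arr s aStamp (reg s' anc) - first es e <= k].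
apply: (runs_while (I := I)).
- by exists w.
- move=> k s3 fr [w' ch' [tr' f1 eqf lek]] /=.
  have eqa a i : arr s3 a i = arr s a i by rewrite (fr.2 a).
  have eqe : reg s3 edg = e by rewrite (fr.1 20).
  rewrite !eqa eqe Fe => cond.
  split; first by lia.
  case: w' ch' tr' eqf cond => [|[e1 t1] w'] /= ch' tr' eqf cond.
    by rewrite ch' sub0n in cond.
  case: ch' => st via par ch'; case/and5P: tr' => _ _ _ _ /andP[old tr'].
  apply: runs_lf => //.
  (* The current stamp is [t1.+1], so it drops at the parent, which pays for this iteration. *)
  have lt1 : arr s aStamp (arr s aParent (reg s3 anc)) <= t1.
    case: (w') ch' old => [|et w1] /=; first by move=> ->.
    by case=> -> _ _ _ /andP[].
  exists w'; rewrite /= !eqa eqe subn_eqP via /=; case: eqP => eqe1 /=; rewrite ?eqa //.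
    split=> //; last by lia.
    by rewrite eqf inE eq_sym eqe1 eqxx orbT.
  split=> //; last by lia.
  by rewrite eqf inE; case: (eqVneq e e1) => // e1e; rewrite e1e in eqe1.
- move=> k s3 fr [w' ch' [tr' f1 eqf lek]] /=.
  have eqa a i : arr s3 a i = arr s a i by rewrite (fr.2 a).
  have eqe : reg s3 edg = e by rewrite (fr.1 20).
  rewrite !eqa eqe Fe eqf => cond.
  have -> : e \in unzip1 w' = false.
    case: w' ch' tr' {eqf} => [|et w'] // [st _ _ _] tr'.
    apply/negbTE/negP => /(trail_head_time tr') /=; move: cond; rewrite st; lia.
  by case: (reg s3 found) f1 => [|[]].
Qed.

Definition at_record s t r :=
  [/\ loaded s, reg s now = t, good_record es starts t r & record_at s (reg s lo) r].

Lemma eq_at_record s s' t r :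
  (forall a p, a < 10 -> arr s' a p = arr s a p) ->
  (forall a p, 10 <= a < 16 -> p <= reg s lo -> arr s' a p = arr s a p) ->
  reg s' now = reg s now -> reg s' lo = reg s lo ->
  at_record s t r -> at_record s' t r.
Proof.
move=> eq1 eq2 eqn eql [ld nw gr ra]; split=> //; first exact: eq_loaded ld.
  by rewrite eqn.
by rewrite eql; apply: eq_record_at ra => a p ha; exact: eq2.
Qed.

Lemma stamp_le s t r : at_record s t r -> arr s aStamp (reg s lo) <= t.
Proof.
case=> _ _ [_ _ tm _] [_ _ _]; case: r.2 tm => [|et w] /=; first by move=> _ ->.
by case/andP=> lt _ [-> _ _ _].
Qed.

(** The stamp is at most [t], and an edge active at [t] has [t <= last_time es e <= first es e + D];
    hence at most [D] links are followed. *)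
Lemma runs_find_active s t r e : at_record s t r -> reg s edg = e ->
  e \in active es m t ->
  runs find s (22 * D + 10) (fun s' => reg s' found = (e \in unzip1 r.2)).
Proof.
move=> at_r ee; rewrite mem_active => /andP[em te].
have [ld _ [_ tr _ _] [_ _ _ ch]] := at_r.
apply: runs_find tr ch _ => //.
have := stamp_le at_r; have := span_le em; have := last_time_ge te; lia.
Qed.

Lemma size_active_le t : size (active es m t) <= D.*2.+1.
Proof. exact: leq_trans (size_active_cover _ _ _) (cover_le t). Qed.

Lemma runs_count_missing s t r : at_record s t r ->
  runs count_missing s (D.*2.+1 * (22 * D + 40) + 10)
    (fun s' => reg s' miss = missing es t r.2).
Proof.
move=> at_r.
apply: (runs_seq_lf (T2 := size (active es m t) * (22 * D + 40) + 2)) => //.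
  have := size_active_le t => /(leq_mul (leqnn (22 * D + 40))).
  by rewrite /= ![(22 * D + 40) * _]mulnC; lia.
move=> s1 fr1 e1.
have at1 : at_record s1 t r.
  by apply: eq_at_record at_r => *; rewrite ?(fr1.1 _ isT) ?(fr1.2 _ _ isT) // e1.
have [ld1 nw1 _ _] := at1.
pose P e := (e \notin unzip1 r.2) && (last_time es e <= t).
pose I k s' := exists pre l, [/\ active es m t = pre ++ l, k = size l,
  bucket (arr s aNext) (arr s aEdge) (reg s' ptr) l & reg s' miss = count P pre].
have -> : size (active es m t) * (22 * D + 40) + 2 =
  size (active es m t) * (1 + (22 * D + 38)).+1 + 2 by lia.
apply: (runs_while (I := I)).
- exists [::], (active es m t); split=> //; last by rewrite e1.
  have [[_ bk] nw _ _] := at_r; rewrite e1 /= nw; exact: bk.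
- move=> k s2 fr [pre [l [eqA -> bk ms]]] /= p0.
  case: l eqA bk => [|e l] eqA /= bk; first by rewrite bk in p0.
  case: bk => _ be lt bk; split=> //.
  have eqa a p : arr s2 a p = arr s1 a p by rewrite (fr.2 a).
  have eqa1 a p : arr s1 a p = arr s a p by rewrite (fr1.2 a).
  have eA : e \in active es m t by rewrite eqA mem_cat mem_head orbT.
  have em : e < m by move: eA; rewrite mem_active => /andP[].
  apply: (runs_seq_lf (T2 := 22 * D + 30)) => // [|s3 fr3 e3]; first by rewrite /=; lia.
  have at3 : at_record s3 t r.
    apply: eq_at_record at1 => [a p _|a p _ _||]; rewrite ?(fr3.2 a) ?eqa //.
      by rewrite (fr3.1 now) // (fr.1 now).
    by rewrite (fr3.1 lo) // (fr.1 lo).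
  have ee : reg s3 edg = e by rewrite e3 /= eqa eqa1.
  apply: (runs_seq (T2 := 20) (runs_find_active at3 ee eA)); last by lia.
  move=> s4 fr4 f4; apply: runs_lf => //.
  have [[ld4 _] nw4 _ _] := at3; have [_ _ _ le _] := ld4 _ em.
  have eqs : [/\ reg s4 now = t, reg s4 edg = e, arr s4 aLast e = last_time es e
    & [/\ reg s4 ptr = reg s2 ptr, reg s4 miss = count P pre &
      forall p, arr s4 aNext p = arr s aNext p]].
    split; [by rewrite (fr4.1 now)|by rewrite (fr4.1 edg)|by rewrite (fr4.2 aLast)|].
    split; [by rewrite (fr4.1 ptr) // (fr3.1 ptr)|by rewrite (fr4.1 miss) // (fr3.1
      miss)|].
    by move=> p; rewrite (fr4.2 aNext) // (fr3.2 aNext) // eqa eqa1.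
  have [n4 e4 l4 [p4 m4 nx4]] := eqs.
  exists (rcons pre e), l; rewrite cat_rcons -cats1 count_cat /= f4 n4 e4 l4.
  rewrite (_ : (_ == 0) = P e); last first.
    by rewrite /P addn_eq0 subn_eq0; case: (_ \in _).
  split=> //.
    by case: (P e); rewrite /= nx4 p4.
  by rewrite addn0; case: (P e); rewrite /= m4 ?addn0 ?addn1.
- move=> k s2 fr [pre [l [eqA _ bk ms]]] /= p0; rewrite ms /missing eqA.
  case: l bk {eqA} => [_|e l [h _ _ _]]; first by rewrite cats0.
  by rewrite p0 in h.
Qed.

Definition segment s q L :=
  forall k, k < size L -> record_at s (q + k) (nth (0, [::]) L k).

Lemma eq_segment s s' q L :
  (forall a p, 10 <= a < 16 -> p < q + size L -> arr s' a p = arr s a p) ->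
  segment s q L -> segment s' q L.
Proof.
move=> eqa sg k lt; apply: eq_record_at (sg k lt) => a p ha le.
by apply: eqa => //; apply: leq_ltn_trans le _; rewrite ltn_add2l.
Qed.

(** The inequality on [aSeen] ensures that no code counts as seen when the next time begins. *)
Definition collected s t acc :=
  [/\ reg s now = t, reg s top = reg s hi + size acc, segment s (reg s hi) acc
    & forall c, arr s aSeen c <= t.+1 /\ (arr s aSeen c == t.+1) = (c \in map code
      acc)].

Lemma eq_collected s s' t acc :
  (forall a p, 10 <= a -> arr s' a p = arr s a p) ->
  reg s' now = reg s now -> reg s' hi = reg s hi -> reg s' top = reg s top ->
  collected s t acc -> collected s' t acc.
Proof.
move=> eqa eqn eqh eqt [h1 h2 h3 h4]; split.
- by rewrite eqn.
- by rewrite eqt eqh.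
- by rewrite eqh; apply: eq_segment h3 => a p /andP[ha _] _; exact: eqa.
- by move=> c; rewrite eqa.
Qed.

(** The analogue of [chain] for a record whose last step is still in registers; its parent must lie
    below [top], where the record will be stored. *)
Definition linked s (w : seq (nat * nat)) : Prop :=
  if w is et :: w' then
    [/\ reg s nstamp = et.2.+1, reg s nvia = et.1, reg s npar < reg s top
      & chain (arr s aStamp) (arr s aVia) (arr s aParent) (reg s npar) w']
  else reg s nstamp = 0.

Lemma runs_push s t acc r :
  collected s t acc -> arr s aOrigin (reg s lo) = origin r ->
  reg s nvtx = endpoint es (origin r) r.2 -> reg s ncode = code r -> linked s r.2 ->
  runs push_record s 50 (fun s' =>
    [/\ collected s' t (push es acc r), reg s top <= reg s' top
      & forall a p, 10 <= a < 16 -> p < reg s top -> arr s' a p = arr s a p]).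
Proof.
move=> [nw tp sg sn] og nv nc lk; apply: runs_lf => //.
have [seen_le seen_eq] := sn (code r).
have -> : run_lf push_record s =
    if code r \in map code acc then s else run_lf append_record s.
  rewrite -seen_eq -subn_eqP -{1 2}nw -nc -[(reg s now).+1]addn1; reflexivity.
rewrite /push; case: ifP => // dup.
set s' := run_lf append_record s.
have below a p : 10 <= a < 16 -> p < reg s top -> arr s' a p = arr s a p.
  move=> /andP[a0 a1] lt; have ne : (p == reg s top) = false by apply/ltn_eqF.
  by rewrite /= ne !andbF; case: (a =P 16) a1 => // ->.
split=> //; last by rewrite /= leq_addr.
split=> //.
- by rewrite size_rcons /= tp addn1 addnS.
- move=> k; rewrite size_rcons ltnS leq_eqVlt => /orP[/eqP->|lt]; last first.
    rewrite nth_rcons lt; apply: eq_record_at (sg k lt) => a p ha le;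
      apply: below => //.
    by rewrite tp; apply: leq_ltn_trans le _; rewrite ltn_add2l.
  rewrite nth_rcons ltnn eqxx -[reg s' hi]/(reg s hi) -tp; split.
  + by rewrite /= eqxx og.
  + by rewrite /= eqxx.
  + by rewrite /= eqxx.
  + case: r.2 lk => [|et w] /=; rewrite !eqxx //.
    case=> -> -> lt ch; split=> //; apply: eq_chain ch => p le.
    by rewrite /= !(ltn_eqF (leq_ltn_trans le lt)).
- move=> c; rewrite map_rcons mem_rcons inE /= nc nw addn1.
  case: (eqVneq c (code r)) => [->|ne] /=; first by rewrite eqxx.
  exact: sn.
Qed.

Lemma runs_keep s t r acc :
  at_record s t r -> collected s t acc -> reg s lo < reg s top ->
  reg s miss = missing es t r.2 ->
  runs keep s 90 (fun s' =>
    [/\ at_record s' t r,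
        collected s' t (foldl (push es) acc (if missing es t r.2 == 0 then [:: r]
          else [::])) &
    forall a p, 10 <= a < 16 -> p < reg s top -> arr s' a p = arr s a p]).
Proof.
move=> at_r col lt ms.
apply: (runs_weaken (T := (1 + 80).+1) (Q := (fun s' =>
    collected s' t (foldl (push es) acc (if missing es t r.2 == 0 then [:: r] else
      [::])) /\
    forall a p, 10 <= a < 16 -> p < reg s top -> arr s' a p = arr s a p))) => //;
      last first.
  move=> s' fr [col' eqa]; split=> //; apply: eq_at_record at_r => [a p ha|a p ha le||].
  - by rewrite (fr.2 a) // !inE; lia.
  - by apply: eqa => //; exact: leq_ltn_trans lt.
  - by rewrite (fr.1 now).
  - by rewrite (fr.1 lo).
apply: runs_if; rewrite /= ms => m0.
  by rewrite (negbTE m0); exact: runs_lf.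
rewrite m0 /=; apply: (runs_seq_lf (T2 := 50)) => // s1 fr1 e1.
have eqa a p : arr s1 a p = arr s a p by rewrite (fr1.2 a).
have et : reg s1 top = reg s top by rewrite (fr1.1 top).
have [_ _ _ [og vx cd ch]] := at_r.
apply: runs_weaken (runs_push (s := s1) (t := t) (acc := acc) (r := r) _ _ _ _ _) _ _
  => //.
- by apply: eq_collected col => [a p _|||]; rewrite ?eqa ?fr1.1.
- by rewrite eqa (fr1.1 lo).
- by rewrite e1 /=.
- by rewrite e1 /=.
- move: ch; rewrite /linked e1; case: r.2 => [|et' w] //= [-> -> pl ch].
  by split=> //; exact: ltn_trans lt.
- by move=> s2 fr2 [h1 _ h2]; split=> // a p ha hp; rewrite h2 ?et ?eqa.
Qed.

Lemma runs_extend s t r acc :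
  at_record s t r -> collected s t acc -> reg s lo < reg s top ->
  reg s miss = missing es t r.2 ->
  runs extend s (D.*2.+1 * (22 * D + 200) + 10) (fun s' =>
    [/\ at_record s' t r,
        collected s' t (foldl (push es) acc
          [seq (r.1, (e, t) :: r.2) | e <- active es m t & extends es starts t r e]) &
    forall a p, 10 <= a < 16 -> p < reg s top -> arr s' a p = arr s a p]).
Proof.
move=> at_r col lt ms.
apply: (runs_seq_lf (T2 := size (active es m t) * (22 * D + 200) + 2)) => //.
  have := size_active_le t => /(leq_mul (leqnn (22 * D + 200))).
  by rewrite /= ![(22 * D + 200) * _]mulnC; lia.
move=> s1 fr1 e1.
have eqa1 a p : arr s1 a p = arr s a p by rewrite (fr1.2 a).
have at1 : at_record s1 t r.
  by apply: eq_at_record at_r => [a p _|a p _ _||]; rewrite ?eqa1 ?fr1.1.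
have col1 : collected s1 t acc by apply: eq_collected col => [a p _|||];
  rewrite ?eqa1 ?fr1.1.
pose ext l := [seq (r.1, (e, t) :: r.2) | e <- l & extends es starts t r e].
pose I k s' := exists pre l, [/\ active es m t = pre ++ l, k = size l,
  bucket (arr s aNext) (arr s aEdge) (reg s' ptr) l & 
  [/\ at_record s' t r, collected s' t (foldl (push es) acc (ext pre)),
   reg s top <= reg s' top & 
   forall a p, 10 <= a < 16 -> p < reg s top -> arr s' a p = arr s a p]].
have -> : size (active es m t) * (22 * D + 200) + 2 =
  size (active es m t) * (1 + (22 * D + 198)).+1 + 2 by lia.
apply: (runs_while (I := I)).
- exists [::], (active es m t); split=> //.
    have [[_ bk] nw _ _] := at_r; rewrite e1 /= nw; exact: bk.
  by split=> //; rewrite fr1.1.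
- move=> k s2 fr [pre [l [eqA -> bk [at2 col2 tp2 below2]]]] /= p0.
  case: l eqA bk => [|e l] eqA /= bk; first by rewrite bk in p0.
  case: bk => _ be ltn bk; split=> //.
  have eqs2 a p : a < 10 -> arr s2 a p = arr s a p.
    by move=> ha; rewrite (fr.2 a) // !inE; lia.
  have eA : e \in active es m t by rewrite eqA mem_cat mem_head orbT.
  have em : e < m by move: eA; rewrite mem_active => /andP[].
  apply: (runs_seq_lf (T2 := 22 * D + 190)) => // [|s3 fr3 e3]; first by rewrite /=;
    lia.
  have eqa3 a p : arr s3 a p = arr s2 a p by rewrite (fr3.2 a).
  have at3 : at_record s3 t r.
    by apply: eq_at_record at2 => [a p _|a p _ _||]; rewrite ?eqa3 ?fr3.1.
  have ee : reg s3 edg = e by rewrite e3 /= eqs2.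
  apply: (runs_seq (T2 := 170) (runs_find_active at3 ee eA)); last by lia.
  move=> s4 fr4 f4.
  have eqa4 a p : arr s4 a p = arr s2 a p by rewrite (fr4.2 a).
  have eqr4 x : x \notin [:: edg; anc; found] -> reg s4 x = reg s2 x.
    by move=> hx; rewrite (fr4.1 x) ?(fr3.1 x) //; move: hx; rewrite !inE; lia.
  have at4 : at_record s4 t r.
    by apply: eq_at_record at2 => [a p _|a p _ _||]; rewrite ?eqa4 ?eqr4.
  have col4 : collected s4 t (foldl (push es) acc (ext pre)).
    by apply: eq_collected col2 => [a p _|||]; rewrite ?eqa4 ?eqr4.
  have [[ld4 _] nw4 [_ _ _ _] [og vx cd ch]] := at4.
  have [E1 E2 _ El Ew] := ld4 _ em.
  have e4 : reg s4 edg = e by rewrite (fr4.1 edg).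
  have ms4 : reg s4 miss = missing es t r.2 by rewrite eqr4 // (fr.1 miss) // (fr1.1
    miss).
  have ce : (eval s4 cannot_extend == 0) = extends es starts t r e.
    rewrite /= f4 ms4 e4 El nw4 E1 E2 vx /extends !addn_eq0 andbA [_ && (_ == 0)]andbAC.
    rewrite /incident; set v := endpoint _ _ _.
    set x1 := _ + _; set x2 := _ + _; have -> : (x1 - (x1 - x2) == 0) = (x1 == 0) ||
      (x2 == 0).
      by apply/eqP/orP => [h|[]/eqP h]; [case: (eqVneq x1 0); [left|right;
        apply/eqP]|..]; lia.
    rewrite /x1 /x2 !subn_eqP eqb0 -andbA.
    by rewrite (_ : 1 - (last_time es e - t) = (last_time es e <= t)) //; case: leqP;
      lia.
  pose r' := (r.1, (e, t) :: r.2).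
  apply: (runs_seq (T1 := 160) (T2 := 3) (Q1 := fun s5 =>
     [/\ collected s5 t (foldl (push es) acc (ext (rcons pre e))), reg s4 top <= reg
       s5 top &
      forall a p, 10 <= a < 16 -> p < reg s4 top -> arr s5 a p = arr s4 a p])) => //.
    rewrite /ext filter_rcons -ce.
    apply: (runs_weaken (T := (expr_cost cannot_extend + 90).+1) _ _ (fun _ _ h =>
      h)) => //.
    apply: runs_if => [ne|->]; first by rewrite (negbTE ne); apply: runs_lf.
    rewrite eqxx map_rcons foldl_rcons -/(ext pre).
    apply: (runs_seq_lf (T2 := 50)) => // s5 fr5 e5.
    have eqa5 a p : arr s5 a p = arr s4 a p by rewrite (fr5.2 a).
    apply: runs_weaken (runs_push (s := s5) (t := t) (acc := foldl (push es) acc (ext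
      pre)) (r := r') _ _ _ _ _) _ _ => //.
    + by apply: eq_collected col4 => [a p _|||]; rewrite ?eqa5 ?fr5.1.
    + by rewrite eqa5 (fr5.1 lo).
    + by rewrite e5 /= e4 E1 E2 vx.
    + by rewrite e5 /= e4 cd Ew /code /= big_cons addnA addnAC.
    + split; rewrite ?e5 /= ?nw4 ?addn1 ?e4 //.
      rewrite eqr4 // (fr.1 lo) // (fr1.1 lo) //.
      by apply: leq_trans lt _; rewrite eqr4.
    + move=> s6 fr6 [h1 tp6 h2]; split=> //; first by apply: leq_trans tp6;
        rewrite fr5.1.
      by move=> a p ha hp; rewrite h2 ?fr5.1 ?eqa5.
  move=> s5 fr5 [col5 tp5 below5]; apply: runs_lf => //.
  exists (rcons pre e), l; split=> //.
  - by rewrite cat_rcons.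
  - rewrite /= (fr5.1 ptr) // eqr4 // (fr5.2 aNext) // eqa4 eqs2 //.
  - have eqr5 x : x \notin [:: 17; 23; 24; 25; 26; 27] -> reg s5 x = reg s4 x.
      by move=> hx; rewrite (fr5.1 x) //; move: hx; rewrite !inE; lia.
    have lt4 : reg s4 lo < reg s4 top.
      rewrite eqr4 // (fr.1 lo) // (fr1.1 lo) //.
      by apply: leq_trans lt _; rewrite eqr4.
    have at5 : at_record s5 t r.
      apply: eq_at_record at4 => [a p ha|a p ha le||]; rewrite ?eqr5 //.
        by rewrite (fr5.2 a) // !inE; lia.
      by apply: below5 => //; exact: leq_ltn_trans lt4.
    split.
    + exact: eq_at_record at5.
    + exact: eq_collected col5.
    + by apply: leq_trans tp2 _; rewrite -eqr4.
    + move=> a p ha hp; rewrite /= below5 // ?eqa4 ?below2 //.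
      by apply: leq_trans hp _; rewrite eqr4.
- move=> k s2 fr [pre [l [eqA _ bk [at2 col2 tp2 below2]]]] /= p0.
  split=> //; case: l bk eqA => [_|e l [h _ _ _]]; first by rewrite cats0 => ->.
  by rewrite p0 in h.
Qed.

(** Two passes over at most [2D + 1] active edges, with a backward search of at most [D] links for
    each edge. *)
Definition process_time := D.*2.+1 * (22 * D + 40) + D.*2.+1 * (22 * D + 200) + 120.

Lemma runs_process s t r acc :
  at_record s t r -> collected s t acc -> reg s lo < reg s top ->
  runs process_record s process_time (fun s' =>
    [/\ loaded s', collected s' t (foldl (push es) acc (successors es starts t r)),
        reg s' lo = (reg s lo).+1 &
    forall a p, 10 <= a < 16 -> p < reg s top -> arr s' a p = arr s a p]).
Proof.
move=> at_r col lt.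
apply: (runs_seq (T2 := D.*2.+1 * (22 * D + 200) + 110) (runs_count_missing at_r));
  last by rewrite /process_time; lia.
move=> s1 fr1 ms1.
have eqa1 a p : arr s1 a p = arr s a p by rewrite (fr1.2 a).
have at1 : at_record s1 t r.
  by apply: eq_at_record at_r => [a p _|a p _ _||]; rewrite ?eqa1 ?fr1.1.
have col1 : collected s1 t acc by apply: eq_collected col => [a p _|||];
  rewrite ?eqa1 ?fr1.1.
have lt1 : reg s1 lo < reg s1 top by rewrite !fr1.1.
apply: (runs_seq (T2 := D.*2.+1 * (22 * D + 200) + 20) (runs_keep at1 col1 lt1 ms1));
  last by lia.
move=> s2 fr2 [at2 col2 below2].
have lo2 : reg s2 lo = reg s lo by rewrite (fr2.1 lo) // fr1.1.
have tp2 : reg s1 top <= reg s2 top.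
  have [_ -> _ _] := col1; have [_ -> _ _] := col2; rewrite (fr2.1 hi) // leq_add2l.
  by case: ifP => //= _; rewrite /push; case: ifP; rewrite ?size_rcons.
have lt2 : reg s2 lo < reg s2 top by rewrite (fr2.1 lo) //; exact: leq_trans tp2.
have ms2 : reg s2 miss = missing es t r.2 by rewrite (fr2.1 miss).
apply: (runs_seq (T2 := 4) (runs_extend at2 col2 lt2 ms2)); last by lia.
move=> s3 fr3 [at3 col3 below3]; apply: runs_lf => //.
rewrite /successors foldl_cat; split.
- by have [ld3 _ _ _] := at3; exact: eq_loaded ld3.
- exact: eq_collected col3.
- by rewrite /= (fr3.1 lo) // lo2 addn1.
- move=> a p ha hp; have hp1 : p < reg s1 top by rewrite fr1.1.
  by rewrite /= below3 ?below2 ?eqa1 //; exact: leq_trans tp2.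
Qed.

Hypothesis loopless : forall i, i < m -> end1 es i != end2 es i.
Hypothesis nonempty : forall i, i < m -> times es i != [::].

Definition swept s t :=
  [/\ loaded s, reg s now = t, segment s (reg s lo) (search es starts t),
      reg s hi = reg s lo + size (search es starts t)
    & reg s top = reg s hi /\ forall c, arr s aSeen c <= t].

Definition max_records := size starts * 2 ^ D.*2.+1.

Lemma size_search_le t : size (search es starts t) <= max_records.
Proof.
apply: leq_trans (search_size (searchP loopless nonempty starts t)) _.
by rewrite leq_mul2l leq_exp2l // cover_le orbT.
Qed.

Lemma runs_time_step s t : swept s t ->
  runs time_step s (max_records * (process_time + 4) + 10) (fun s' => swept s' t.+1).
Proof.
set L := search es starts t => -[ld nw sg hiE [tp sn]].
have [sound _ _] := searchP loopless nonempty starts t.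
have szL : size L <= max_records by exact: size_search_le.
apply: (runs_seq (T1 := size L * (3 + process_time).+1 + 4) (T2 := 6) (Q1 := fun s' =>
  [/\ loaded s', collected s' t (search es starts t.+1) & reg s' lo = reg s' hi]));
    last first.
- move: szL => /(leq_mul (leqnn (process_time + 4))).
  by rewrite ![(process_time + 4) * _]mulnC; lia.
- move=> s1 fr1 [ld1 [nw1 tp1 sg1 sn1] lo1]; apply: runs_lf => //.
  split.
  + exact: eq_loaded ld1.
  + by rewrite /= nw1 addn1.
  + by apply: (eq_segment (s := s1)) => //=; rewrite lo1.
  + by rewrite /= lo1.
  + by split=> // c /=; have [] := sn1 c.
pose I k s' := exists pre l, [/\ L = pre ++ l, k = size l, reg s' lo + size l = reg s
  hi,
  segment s' (reg s' lo) l & loaded s' /\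
  collected s' t (foldl (push es) [::] (flatten (map (successors es starts t) pre)))].
apply: (runs_while (I := I)).
- exists [::], L; split=> //; split=> //; split=> //=; first by rewrite addn0.
  by move=> c; have := sn c => le; split; [exact: leqW | apply/ltn_eqF].
- move=> k s1 fr [pre [l [eqL -> loE sg1 [ld1 col1]]]] /= cond.
  have hi1 : reg s1 hi = reg s hi by rewrite (fr.1 hi).
  case: l eqL loE sg1 => [|r l] eqL loE sg1.
    by move: cond; rewrite hi1 -loE addn0 subnn.
  split=> //; have [nw1 tp1 _ _] := col1.
  have at1 : at_record s1 t r.
    split=> //; first by apply: sound; rewrite -/L eqL mem_cat mem_head orbT.
    by have := sg1 0 isT; rewrite addn0.
  have lt1 : reg s1 lo < reg s1 top by rewrite tp1 hi1 -loE /=; lia.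
  apply: runs_weaken (runs_process at1 col1 lt1) _ _ => // s2 fr2 [ld2 col2 lo2 below2].
  exists (rcons pre r), l; split=> //.
  + by rewrite cat_rcons.
  + by rewrite lo2 addSn -addnS.
  + move=> k' lt'; have := sg1 k'.+1 lt'; rewrite lo2 addSn -addnS /=.
    apply: eq_record_at => a p ha le; apply: below2 => //.
    by rewrite tp1 hi1 -loE; move: le lt' => /=; lia.
  + by split=> //; rewrite map_rcons flatten_rcons foldl_cat.
- move=> k s1 fr [pre [l [eqL _ loE sg1 [ld1 col1]]]] /= cond.
  have hi1 : reg s1 hi = reg s hi by rewrite (fr.1 hi).
  have l0 : l = [::] by apply: size0nil; move: cond; rewrite hi1 -loE; lia.
  rewrite l0 cats0 in eqL; split=> //; first by rewrite -/L /search_step eqL.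
  by rewrite hi1 -loE l0 addn0.
Qed.

Definition sweep_time := horizon es m * (max_records * (process_time + 4) + 14) + 20.

Lemma runs_sweep s : loaded s -> reg s hor = horizon es m ->
  segment s 0 (search es starts 0) -> reg s top = size starts ->
  (forall c, arr s aSeen c = 0) ->
  runs sweep s sweep_time (fun s' => swept s' (horizon es m)).
Proof.
move=> ld hr sg tp sn.
apply: (runs_seq_lf (T2 := horizon es m * (3 + (max_records * (process_time + 4) +
  10)).+1 + 4)) => //.
  by rewrite /sweep_time /=; lia.
move=> s1 fr1 e1.
pose I k s' := exists2 t, swept s' t & t + k = horizon es m.
apply: (runs_while (I := I)).
- exists 0 => //; rewrite e1; split=> //.
  + by rewrite /= tp size_map size_iota.
  + by split=> // c /=; rewrite sn.
- move=> k s2 fr [t sw tk] /=; have [_ nw _ _ _] := sw.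
  rewrite (fr.1 hor) // (fr1.1 hor) // hr nw => cond; split; first by lia.
  apply: runs_weaken (runs_time_step sw) _ _ => // s3 _ sw3.
  by exists t.+1 => //; lia.
- move=> k s2 fr [t sw tk] /=; have [_ nw _ _ _] := sw.
  rewrite (fr.1 hor) // (fr1.1 hor) // hr nw => cond.
  by rewrite (_ : horizon es m = t) //; lia.
Qed.

Lemma runs_accept s : swept s (horizon es m) -> reg s res = 0 ->
  runs accept s (max_records * 30 + 4) (fun s' => accepting s' <->
    exists2 r, r \in search es starts (horizon es m) &
      origin r = endpoint es (origin r) r.2).
Proof.
set L := search _ _ _ => -[ld nw sg hiE [tp sn]] r0.
have szL : size L <= max_records by exact: size_search_le.
apply: (runs_weaken (T := size L * (3 + 20).+1 + 4) _ _ (fun _ _ h => h)); last by lia.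
pose I k s' := exists pre l, [/\ L = pre ++ l, k = size l, reg s' lo + size l = reg s
  top &
  reg s' res != 0 <-> exists2 r, r \in pre & origin r = endpoint es (origin r) r.2].
apply: (runs_while (I := I)).
- exists [::], L; split=> //; first by rewrite tp hiE.
  by split=> [|[]]; rewrite ?r0.
- move=> k s1 fr [pre [l [eqL -> loE rs]]] /= cond.
  have tp1 : reg s1 top = reg s top by rewrite (fr.1 top).
  case: l eqL loE => [|r l] eqL loE.
    by move: cond; rewrite tp1 -loE addn0 subnn.
  split=> //; apply: runs_lf => //.
  have eqa a p : arr s1 a p = arr s a p by rewrite (fr.2 a).
  have [og vx _ _] : record_at s (reg s1 lo) r.
    have lt : size pre < size L by rewrite eqL size_cat /=; lia.
    have := sg _ lt; rewrite -/L eqL nth_cat ltnn subnn /=.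
    suff -> : reg s lo + size pre = reg s1 lo by [].
    by move: loE; rewrite tp hiE -/L eqL size_cat /=; lia.
  exists (rcons pre r), l; rewrite /= !eqa subn_eqP og vx.
  split=> //; first by rewrite cat_rcons.
    by case: ifP => _ /=; rewrite addn1 addSn -addnS.
  case: ifP => /= [/eqP cl|ncl].
    by split=> // _; exists r; rewrite // mem_rcons mem_head.
  split=> [/rs[r1 h1 h2]|[r1]]; first by exists r1; rewrite // mem_rcons inE h1 orbT.
  rewrite mem_rcons inE => /orP[/eqP->|h1 h2]; first by move/eqP; rewrite ncl.
  by apply/rs; exists r1.
- move=> k s1 fr [pre [l [eqL _ loE rs]]] /= cond.
  have l0 : l = [::] by apply: size0nil; move: cond; rewrite (fr.1 top) // -loE; lia.
  by rewrite eqL l0 cats0.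
Qed.

End Sweep.

(** * Programs that read the input and set up the candidate starts *)

Definition min_step :=
  Assign minlast (Both (Reg minlast) (Read aLast (Reg cur))) ;; Incr cur.

Definition find_min :=
  (Assign minlast (Read aLast (Const 0)) ;; Assign cur (Const 0)) ;;
  While (Sub (Reg nedges) (Reg cur)) min_step.

(** After parsing, [weight] is [2 ^ m]; increasing [base] by it produces the codes [j * 2 ^ m] of
    the empty trails without multiplication. *)
Definition add_root a :=
  Write aOrigin (Reg top) (Read a (Reg cur)) ;;
  Write aVertex (Reg top) (Read a (Reg cur)) ;;
  Write aCode (Reg top) (Reg base) ;;
  Write aStamp (Reg top) (Const 0) ;;
  Incr top ;;
  Assign base (Add (Reg base) (Reg weight)).

Definition seed_step :=
  If (Sub (Read aFirst (Reg cur)) (Reg minlast)) Skip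
    (add_root aEnd1 ;; add_root aEnd2) ;;
  Incr cur.

Definition seed :=
  Assign cur (Const 0) ;; While (Sub (Reg nedges) (Reg cur)) seed_step.

(** [a + (b - a)] with truncated subtraction is the maximum of [a] and [b]; [close_edge] uses the
    same device. *)
Definition read_time :=
  Assign tmp (Read aInput (Reg pos)) ;;
  Write aNext (Reg pos) (Read aHead (Reg tmp)) ;;
  Write aEdge (Reg pos) (Reg cur) ;;
  Write aHead (Reg tmp) (Reg pos) ;;
  Assign lofirst (Both (Reg lofirst) (Reg tmp)) ;;
  Assign hilast (Add (Reg hilast) (Sub (Reg tmp) (Reg hilast))) ;;
  Incr pos ;;
  Assign left (Sub (Reg left) (Const 1)).

Definition close_edge :=
  Write aFirst (Reg cur) (Reg lofirst) ;;
  Write aLast (Reg cur) (Reg hilast) ;;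
  Write aWeight (Reg cur) (Reg weight) ;;
  Assign weight (Add (Reg weight) (Reg weight)) ;;
  Assign span (Add (Reg span) (Sub (Sub (Reg hilast) (Reg lofirst)) (Reg span))) ;;
  Assign hor (Add (Reg hor) (Sub (Add (Reg hilast) (Const 1)) (Reg hor))) ;;
  Assign now (Reg lofirst).

(** The threshold uses the span of the edges read so far. [now] runs through the span of the new
    edge, where alone the load changes. *)
Definition cover_step :=
  Write aCover (Reg now) (Add (Read aCover (Reg now)) (Const 1)) ;;
  If (Sub (Read aCover (Reg now)) (Add (Add (Reg span) (Reg span)) (Const 1)))
    (Assign bad (Const 1)) Skip ;;
  Incr now.

(** The first listed time initialises the minimum. For an edge without times the value read there is
    meaningless, but [read_edge] then sets [bad]. *)
Definition open_edge :=
  Write aEnd1 (Reg cur) (Read aInput (Reg pos)) ;;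
  Write aEnd2 (Reg cur) (Read aInput (Add (Reg pos) (Const 1))) ;;
  Assign left (Read aInput (Add (Reg pos) (Const 2))) ;;
  Assign pos (Add (Reg pos) (Const 3)) ;;
  Assign lofirst (Read aInput (Reg pos)) ;;
  Assign hilast (Const 0).

(* Clearing [nedges] leaves the loop over the edges. *)
Definition next_edge := Incr cur ;; If (Reg bad) (Assign nedges (Const 0)) Skip.

Definition read_edge :=
  open_edge ;;
  If (Reg left)
    (While (Reg left) read_time ;;
     close_edge ;;
     While (Sub (Add (Reg hilast) (Const 1)) (Reg now)) cover_step)
    (Assign bad (Const 1)) ;;
  next_edge.

Definition parse :=
  (Assign pos (Const 2) ;; Assign weight (Const 1)) ;;
  While (Sub (Reg nedges) (Reg cur)) read_edge.

Definition decide :=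
  find_min ;; seed ;; sweep ;; accept.

(** Without edges the empty walk is a circuit as soon as there is a vertex, so the number of
    vertices itself serves as the answer. *)
Definition main_program :=
  Assign nedges (Read aInput (Const 1)) ;;
  If (Reg nedges) (parse ;; If (Reg bad) Skip decide)
    (Assign res (Read aInput (Const 0))).

(** * Correctness of the candidate starts *)

Section Seed.

Variable es : seq (nat * nat * seq nat).
Local Notation m := (size es).

Lemma runs_find_min s : loaded_upto es m s -> reg s nedges = m -> 0 < m ->
  runs find_min s (m * 20 + 20) (fun s' => reg s' minlast = min_last es m).
Proof.
move=> [ld _] nm m0.
apply: (runs_seq_lf (T2 := m * (3 + 16).+1 + 4)) => // [|s1 fr1 e1].
  by rewrite /=; lia.
pose I k s' := exists2 i, i + k = m & reg s' cur = i /\ reg s' minlast = min_last es i.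
apply: (runs_while (I := I)).
- by exists 0 => //; rewrite e1 /=; have [_ _ _ -> _] := ld 0 m0.
- move=> k s2 fr [i ik [ci mi]] /=; rewrite (fr.1 nedges) // (fr1.1 nedges) // nm ci
    => cond.
  split; first by lia.
  have im : i < m by lia.
  apply: runs_lf => //; exists i.+1; first by lia.
  rewrite /= ci mi (fr.2 aLast) // (fr1.2 aLast) //; have [_ _ _ -> _] := ld i im.
  by rewrite addn1; split=> //; lia.
- move=> k s2 fr [i ik [ci ->]] /=; rewrite (fr.1 nedges) // (fr1.1 nedges) // nm ci
    => cond.
  by congr (min_last es _); lia.
Qed.

Definition seeded s (c : seq nat) :=
  [/\ reg s top = size c, reg s base = size c * 2 ^ m
    & forall k, k < size c -> [/\ arr s aOrigin k = nth 0 c k, arr s aVertex k = nth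
      0 c k,
        arr s aCode k = k * 2 ^ m & arr s aStamp k = 0]].

Lemma runs_add_root s a c v : seeded s c -> a < 10 -> arr s a (reg s cur) = v ->
  reg s weight = 2 ^ m ->
  runs (add_root a) s 30 (fun s' => seeded s' (rcons c v)).
Proof.
move=> [tp bs sd] a10 av wt; apply: runs_lf => //.
have na : (a == 10) = false by apply/ltn_eqF.
rewrite /= na /= av tp bs wt; split; rewrite ?size_rcons /= ?addn1 //.
  by rewrite mulSn addnC.
move=> k; rewrite ltnS leq_eqVlt nth_rcons => /orP[/eqP->|lt];
  first by rewrite ltnn eqxx /= ?eqxx ?bs.
by rewrite lt /= !(ltn_eqF lt); exact: sd.
Qed.

Lemma runs_seed s : loaded_upto es m s -> reg s nedges = m -> reg s weight = 2 ^ m ->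
  reg s minlast = min_last es m -> reg s top = 0 -> reg s base = 0 ->
  runs seed s (m * 90 + 20) (fun s' => seeded s' (candidates es (min_last es m) m)).
Proof.
move=> [ld _] nm wt mn tp bs.
apply: (runs_seq_lf (T2 := m * (3 + 80).+1 + 4)) => // [|s1 fr1 e1].
  by rewrite /=; lia.
pose I k s' := exists2 i, i + k = m & reg s' cur = i /\
  seeded s' (candidates es (min_last es m) i).
apply: (runs_while (I := I)).
- by exists 0 => //; rewrite e1; split=> //; split.
- move=> k s2 fr [i ik [ci sd]] /=; rewrite (fr.1 nedges) // (fr1.1 nedges) // nm ci
    => cond.
  split; first by lia.
  have im : i < m by lia.
  have [E1 E2 Ef _ _] := ld i im.
  have eqa a p : a < 10 -> arr s2 a p = arr s a p.
    by move=> ha; rewrite (fr.2 a) ?(fr1.2 a) // !inE; lia.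
  apply: (runs_seq (T1 := 70) (T2 := 4) (Q1 := fun s' =>
    seeded s' (candidates es (min_last es m) i.+1))) => //; last first.
    move=> s3 fr3 sd3; apply: runs_lf => //; exists i.+1; first by lia.
    by rewrite /= (fr3.1 cur) // ci addn1.
  apply: (runs_weaken (T := (4 + 62).+1) _ _ (fun _ _ h => h)) => //.
  apply: runs_if; rewrite /= ci eqa // Ef (fr.1 minlast) // (fr1.1 minlast) // mn => cf.
    by apply: runs_lf => //=; rewrite leqNgt; case: ltnP cf => [|le];
      rewrite ?cats0 //; lia.
  rewrite (_ : first es i <= min_last es m); last by lia.
  have wt2 : reg s2 weight = 2 ^ m by rewrite (fr.1 weight) // (fr1.1 weight).
  apply: (runs_seq (T2 := 30) (runs_add_root (v := end1 es i) (a := aEnd1) sd _ _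
    wt2)) => //.
    by rewrite ci eqa.
  move=> s3 fr3 sd3.
  rewrite -[[:: end1 es i; _]]/([:: end1 es i] ++ [:: end2 es i]) catA !cats1.
  apply: runs_add_root => //; last by rewrite (fr3.1 weight).
  by rewrite (fr3.1 cur) // ci (fr3.2 aEnd2) // eqa.
- move=> k s2 fr [i ik [ci sd]] /=; rewrite (fr.1 nedges) // (fr1.1 nedges) // nm ci
    => cond.
  by rewrite (_ : m = i) in sd *; last by lia.
Qed.

Lemma seeded_segment s starts : seeded s starts ->
  segment es starts s 0 (search es starts 0).
Proof.
move=> [tp _ sd] k; rewrite size_map size_iota add0n => lt.
rewrite (nth_map 0) ?size_iota // nth_iota // add0n.
have [og vx cd st] := sd k lt; split=> //.
by rewrite cd /code /= big_nil addn0.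
Qed.

End Seed.

(** * Reading the input with early rejection *)

Section Parse.

Variables (es : seq (nat * nat * seq nat)) (input : seq nat) (D Hmax : nat).
Local Notation m := (size es).

Definition encode_numbers (r : nat * nat * seq nat) : seq nat :=
  [:: r.1.1, r.1.2, size r.2 & r.2].

Hypothesis input_edges : drop 2 input = flatten (map encode_numbers es).
Hypothesis times_uniq : forall i, i < m -> uniq (times es i).
Hypothesis span_le : forall i, i < m -> last_time es i - first es i <= D.
Hypothesis last_lt : forall i, i < m -> last_time es i < Hmax.

Lemma size_times_le i : i < m -> size (times es i) <= D.+1.
Proof.
move=> im; rewrite -(size_iota (first es i) D.+1); apply: uniq_leq_size;
  first exact: times_uniq.
move=> t ti; rewrite mem_iota; have := span_le im.
by have := first_le ti; have := last_time_ge ti; lia.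
Qed.

Lemma runs_read_times s i p : i < m -> let ts := times es i in
  reg s cur = i -> reg s pos = p -> 0 < p ->
  (forall j, j < size ts -> arr s aInput (p + j) = nth 0 ts j) ->
  reg s left = size ts -> reg s lofirst = head 0 ts -> reg s hilast = 0 ->
  (forall t, bucket (arr s aNext) (arr s aEdge) (arr s aHead t) (active es i t) /\
    arr s aHead t < p) ->
  runs (While (Reg left) read_time) s (size ts * 50 + 2) (fun s' =>
    [/\ reg s' pos = p + size ts, reg s' lofirst = first es i,
        reg s' hilast = last_time es i &
     forall t, bucket (arr s' aNext) (arr s' aEdge) (arr s' aHead t) (active es i.+1
       t) /\
       arr s' aHead t < p + size ts]).
Proof.
move=> im ts ci ps p0 inp lf lo0 hi0 bk.
pose I k s' := exists2 j, j + k = size ts & [/\ reg s' left = k, reg s' pos = p + j,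
   reg s' lofirst = foldl minn (head 0 ts) (take j ts),
   reg s' hilast = foldl maxn 0 (take j ts) &
   forall t, bucket (arr s' aNext) (arr s' aEdge) (arr s' aHead t)
       (if t \in take j ts then i :: active es i t else active es i t) /\
       arr s' aHead t < p + j].
apply: (runs_weaken (T := size ts * (1 + 48).+1 + 2) _ _ (fun _ _ h => h)) => //.
apply: (runs_while (I := I)).
- by exists 0 => //; rewrite take0 addn0; split.
- move=> k s1 fr [j jk [lk pj lj hj bj]] /=; rewrite lk => k0; split; first by lia.
  have jt : j < size ts by lia.
  have ij : arr s1 aInput (p + j) = nth 0 ts j by rewrite (fr.2 aInput) // inp.
  have ci1 : reg s1 cur = i by rewrite (fr.1 cur).
  apply: runs_lf => //; exists j.+1; first by lia.
  (* The times of an edge are distinct, so it has not yet been put into the bucket of this time. *)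
  have nin : nth 0 ts j \notin take j ts.
    have := times_uniq im; rewrite -/ts -{1}(cat_take_drop j.+1 ts) (take_nth 0) //.
    by rewrite cat_uniq rcons_uniq => /andP[/andP[]].
  rewrite (take_nth 0) // !foldl_rcons /= pj ij lk lj hj ci1.
  set x := nth 0 ts j in nin *; split; try lia.
  move=> t; rewrite mem_rcons inE; case: (eqVneq t x) => [->|ne] /=; last first.
    have [b lt] := bj t; split; last by lia.
    by apply: eq_bucket b => q le; rewrite !ltn_eqF //; exact: leq_ltn_trans lt.
  have [b lt] := bj x; rewrite (negbTE nin) in b; rewrite !eqxx; split; last by lia.
  split=> //; first by lia.
  by apply: eq_bucket b => q le; rewrite !ltn_eqF //; exact: leq_ltn_trans lt.
- move=> k s1 fr [j jk [lk pj lj hj bj]] /=; rewrite lk => k0.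
  have -> : size ts = j by lia.
  have tj : take j ts = ts by apply: take_oversize; lia.
  by rewrite tj in lj hj bj; split.
Qed.

Lemma runs_cover s i : i < m -> times es i != [::] ->
  reg s now = first es i -> reg s hilast = last_time es i ->
  reg s span = max_span es i.+1 -> reg s bad = 0 ->
  (forall t, arr s aCover t = coverage es i t) ->
  runs (While (Sub (Add (Reg hilast) (Const 1)) (Reg now)) cover_step) s (D.+1 * 40 +
    6) (fun s' =>
    (forall t, arr s' aCover t = coverage es i.+1 t) /\
    ((reg s' bad = 0 /\ forall t, first es i <= t <= last_time es i ->
        coverage es i.+1 t <= (max_span es i.+1).*2.+1) \/
     (reg s' bad != 0 /\ exists t, (max_span es i.+1).*2.+1 < coverage es i.+1 t))).
Proof.
move=> im ne nw hl sp bd cv; set B := (max_span es i.+1).*2.+1.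
have fl : first es i <= last_time es i by apply: first_le; exact: last_time_in.
set k0 := (last_time es i).+1 - first es i.
have k0D : k0 <= D.+1 by have := span_le im; rewrite /k0; lia.
pose I k s' := exists2 t0, t0 + k = (last_time es i).+1 &
  [/\ first es i <= t0, reg s' now = t0,
    forall t, arr s' aCover t = coverage es i t + (first es i <= t < t0) &
    ((reg s' bad = 0 /\ forall t, first es i <= t < t0 -> coverage es i.+1 t <= B) \/
     (reg s' bad != 0 /\ exists t, B < coverage es i.+1 t))].
apply: (runs_weaken (T := k0 * (5 + 34).+1 + 6) _ _ (fun _ _ h => h)); last by lia.
apply: (runs_while (I := I)).
- exists (first es i); first by rewrite /k0; lia.
  split=> // [t|]; first by rewrite cv ltnNge andbN addn0.
  by left; split=> // t; rewrite ltnNge andbN.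
- move=> k s1 fr [t0 tk [ft n1 cv1 alt]] /=; rewrite (fr.1 hilast) // hl n1 => cond.
  split; first by lia.
  have sp1 : reg s1 span = max_span es i.+1 by rewrite (fr.1 span).
  have c0 : coverage es i t0 + 1 = coverage es i.+1 t0.
    by rewrite /= ft (_ : t0 <= last_time es i) //; lia.
  apply: runs_lf => //; exists t0.+1; first by lia.
  rewrite [run_lf _ _]/= n1 eqxx /= !cv1 sp1 ltnn andbF addn0 c0.
  set s2 := if _ then _ else _.
  have [r2 a2] : reg s2 now = t0 /\ forall t, arr s2 aCover t =
      if t == t0 then coverage es i.+1 t0 else arr s1 aCover t.
    by rewrite /s2; case: ifP.
  split; rewrite ?r2 ?addn1 //=.
  + by rewrite ltnW.
  + move=> t; rewrite a2; case: (eqVneq t t0) => [->|nt];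
      first by rewrite ft ltnSn -c0 addn1.
    by rewrite cv1 ltnS (leq_eqVlt t) (negbTE nt).
  + rewrite /s2; case: ifP => over /=.
      case: alt => [[b0 le]|]; last by right.
      left; split=> // t /andP[f1]; rewrite ltnS leq_eqVlt => /orP[/eqP->|lt].
        by rewrite /B; lia.
      by apply: le; rewrite f1.
    by right; split=> //; exists t0; rewrite /B; lia.
- move=> k s1 fr [t0 tk [ft n1 cv1 alt]] /=; rewrite (fr.1 hilast) // hl n1 => cond.
  have t0E : t0 = (last_time es i).+1 by lia.
  by rewrite t0E in cv1 alt; split=> // t; rewrite cv1 ltnS.
Qed.

Definition parsed s i :=
  [/\ [/\ reg s cur = i, reg s nedges = m & reg s bad = 0],
      drop (reg s pos) input = flatten (map encode_numbers (drop i es)) /\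
        0 < reg s pos,
      loaded_upto es i s /\ (forall t, arr s aHead t < reg s pos),
      [/\ reg s weight = 2 ^ i, reg s span = max_span es i & reg s hor = horizon es i] &
      [/\ forall t, arr s aCover t = coverage es i t,
          forall t, coverage es i t <= (max_span es i).*2.+1 &
          forall j, j < i -> times es j != [::]]].

(** The two grounds for rejection: an edge that can never be used, or a prefix of the edges
    violating its own load bound. *)
Definition overloaded :=
  (exists2 i, i < m & times es i = [::]) \/
  exists i t, i <= m /\ (max_span es i).*2.+1 < coverage es i t.

Definition edge_time := D.+1 * 90 + 150.

Lemma runs_read_edge s i : i < m -> parsed s i ->
  (forall p, arr s aInput p = nth 0 input p) ->
  runs read_edge s edge_time (fun s' =>
    parsed s' i.+1 \/ [/\ reg s' bad != 0, reg s' nedges = 0 & overloaded]).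
Proof.
move=> im [[ci nm bd] [dr p0] [[ld bk] hd] [wt sp hr] [cv cle ne]] inp.
set p := reg s pos in dr p0 hd *.
have drE : drop p input = encode_numbers (edge es i) ++ flatten (map encode_numbers
  (drop i.+1 es)).
  by rewrite dr (drop_nth (0, 0, [::])).
have inpE j : nth 0 input (p + j) = nth 0 (encode_numbers (edge es i) ++ flatten (map
  encode_numbers (drop i.+1 es))) j.
  by rewrite -drE nth_drop.
apply: (runs_seq_lf (T2 := D.+1 * 90 + 110)) => // [|s1 fr1 e1];
  first by rewrite /edge_time /=; lia.
have r1 : [/\ reg s1 left = size (times es i), reg s1 pos = p + 3, reg s1 hilast = 0 &
    reg s1 lofirst = nth 0 input (p + 3)].
  rewrite e1 /= -/p !inp; split=> //; by rewrite inpE.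
have [lf1 ps1 hl1 fi1] := r1.
have a1 : arr s1 aEnd1 i = end1 es i /\ arr s1 aEnd2 i = end2 es i.
  by rewrite e1 /= ci eqxx !inp -[reg s 3]/p -{1}[p]addn0 !inpE.
have a1' j : j < i -> arr s1 aEnd1 j = end1 es j /\ arr s1 aEnd2 j = end2 es j.
  by move=> lt; rewrite e1 /= ci !(ltn_eqF lt); have [-> -> _ _ _] := ld j lt.
have eqa1 a q : a \notin [:: aEnd1; aEnd2] -> arr s1 a q = arr s a q.
  by move=> ha; rewrite (fr1.2 a).
have eqr1 x : x \notin [:: pos; left; lofirst; hilast] -> reg s1 x = reg s x.
  by move=> hx; rewrite (fr1.1 x) //; move: hx; rewrite !inE; lia.
(* [cur] advances only in [next_edge], after the branch, and the intermediate condition anticipates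
   this. The 90 is 50 for each of at most [D.+1] times read plus 40 for each of at most [D.+1] load
   updates. *)
apply: (runs_seq (T1 := D.+1 * 90 + 95) (T2 := 15) (Q1 := fun s' =>
    parsed (set_reg s' cur i.+1) i.+1 \/ (reg s' bad != 0 /\ overloaded))); last by lia.
  apply: (runs_weaken (T := (1 + (D.+1 * 90 + 92)).+1) _ _ (fun _ _ h => h));
    last by lia.
  apply: runs_if => /=; rewrite lf1 => sz; last first.
    apply: runs_lf => //; right; split=> //; left; exists i => //; exact: size0nil.
  have nei : times es i != [::] by rewrite -size_eq0.
  apply: (runs_seq (T1 := size (times es i) * 50 + 2) (T2 := D.+1 * 40 + 60)
    (runs_read_times (s := s1) (p := p + 3) im _ _ _ _ _ _ _ _)) => //.
  - by rewrite eqr1.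
  - by rewrite addn_gt0 orbT.
  - move=> j jt; rewrite eqa1 // inp -addnA inpE /encode_numbers /= nth_cat.
    by rewrite -/(times es i) jt.
  - rewrite fi1 inpE /=; move: nei; rewrite -/(times es i); by case: (times es i).
  - move=> t; have := hd t; have := bk t; rewrite eqa1 // => b lt; split; last by lia.
    by apply: eq_bucket b => q _; rewrite !eqa1.
  - move=> s2 fr2 [ps2 fi2 hl2 bk2].
    have eqa2 a q : a \notin [:: aNext; aEdge; aHead] -> arr s2 a q = arr s1 a q.
      by move=> ha; rewrite (fr2.2 a).
    have eqr2 x : x \notin [:: tmp; lofirst; hilast; pos; left] -> reg s2 x = reg s1 x.
      by move=> hx; rewrite (fr2.1 x).
    apply: (runs_seq_lf (T2 := D.+1 * 40 + 6)) => // [|s3 fr3 e3];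
      first by rewrite /=; lia.
    have eqa3 a q : a \notin [:: aFirst; aLast; aWeight] -> arr s3 a q = arr s2 a q.
      by move=> ha; rewrite (fr3.2 a).
    have eqr3 x : x \notin [:: weight; span; hor; now] -> reg s3 x = reg s2 x.
      by move=> hx; rewrite (fr3.1 x).
    have ci2 : reg s2 cur = i by rewrite eqr2 // eqr1.
    have r3 : [/\ reg s3 weight = 2 ^ i.+1, reg s3 span = max_span es i.+1,
       reg s3 hor = horizon es i.+1 & reg s3 now = first es i].
      rewrite e3 /= (eqr2 weight) // (eqr2 span) // (eqr2 hor) // !eqr1 // wt sp hr
        fi2 hl2 expnS.
      by split=> //; lia.
    have a3 : [/\ arr s3 aFirst i = first es i, arr s3 aLast i = last_time es i &
       arr s3 aWeight i = 2 ^ i].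
      by rewrite e3 /= ci2 eqxx fi2 hl2 (eqr2 weight) // eqr1.
    have a3' j : j < i -> [/\ arr s3 aFirst j = first es j, arr s3 aLast j =
      last_time es j &
       arr s3 aWeight j = 2 ^ j].
      move=> lt; rewrite e3 /= ci2 !(ltn_eqF lt) !eqa2 // !eqa1 //.
      by have [_ _ -> -> ->] := ld j lt.
    have [w3 sp3 hr3 nw3] := r3; have [af3 al3 aw3] := a3; have [ae1 ae2] := a1.
    apply: (runs_weaken (runs_cover (s := s3) im nei nw3 _ sp3 _ _)) => //.
    + by rewrite eqr3.
    + by rewrite eqr3 // eqr2 // eqr1.
    + by move=> t; rewrite eqa3 // eqa2 // eqa1.
    move=> s4 fr4 [cv4 [[bd4 le4]|[bd4 ex4]]]; last first.
      right; split=> //; right; case: ex4 => t lt; by exists i.+1, t.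
    have eqa4 a q : a \notin [:: aCover] -> arr s4 a q = arr s3 a q.
      by move=> ha; rewrite (fr4.2 a).
    left; split.
    + split=> //=; by rewrite (fr4.1 nedges) // eqr3 // eqr2 // eqr1.
    + have -> : reg (set_reg s4 cur i.+1) pos = p + 3 + size (times es i).
        by rewrite /= (fr4.1 pos) // eqr3.
      split; last by lia.
      by rewrite -addnA addnC -drop_drop drE drop_size_cat.
    + split; last by move=> t; have [_] := bk2 t;
        rewrite /= (fr4.1 pos) // (fr4.2 aHead) // eqr3 // eqa3 // ps2.
      split=> [j|t] /=; last first.
        have [b _] := bk2 t; rewrite (fr4.2 aHead) // eqa3 //;
          apply: eq_bucket b => q _.
        by rewrite !eqa4 // !eqa3.
      rewrite ltnS leq_eqVlt => /orP[/eqP->|lt].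
        by rewrite !eqa4 // (eqa3 aEnd1) // (eqa3 aEnd2) // !eqa2.
      have [-> -> ->] : [/\ arr s4 aFirst j = first es j, arr s4 aLast j = last_time
        es j &
        arr s4 aWeight j = 2 ^ j] by rewrite !eqa4 //; exact: a3'.
      by rewrite !eqa4 // !eqa3 // !eqa2 //; have [-> ->] := a1' j lt.
    + by rewrite /= (fr4.1 weight) // (fr4.1 span) // (fr4.1 hor).
    + split=> // [t|j]; last by rewrite ltnS leq_eqVlt => /orP[/eqP->|/ne].
      case: (boolP (first es i <= t <= last_time es i)) => [/le4//|nin].
      (* Outside the span of the new edge the load is unchanged, while the threshold can only
         grow. *)
      by rewrite /= (negbTE nin) addn0; apply: leq_trans (cle t) _; lia.
  by have := size_times_le im; lia.
move=> s2 fr2 h2; have ci2 : reg s2 cur = i by rewrite (fr2.1 cur) // eqr1.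
apply: runs_lf => //=; rewrite ci2 addn1.
case: h2 => [pr|[bd2 ov]]; last by right; rewrite (negbTE bd2); split.
by left; have [[_ _ /= ->] _ _ _ _] := pr.
Qed.

Definition max_edges := Hmax * D.*2.+1.

(** As long as nothing is rejected, each of the [Hmax] times is straddled by at most [2D + 1] of the
    edges read, and each of these edges straddles some time. So reading ends in time however long
    the input is. *)
Lemma parsed_le s i : i <= m -> parsed s i -> i <= max_edges.
Proof.
move=> im [_ _ _ _ [_ cle ne]].
have spn : max_span es i <= D by apply: max_span_le => j ji; apply: span_le;
  exact: leq_trans im.
apply: leq_trans (@leq_sum_cover es i Hmax _) _.
  move=> j ji; rewrite last_lt ?(leq_trans ji) // andbT.
  by apply: first_le; apply: last_time_in; exact: ne.
rewrite /max_edges -[X in _ <= X * _](card_ord Hmax) -sum_nat_const.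
by apply: leq_sum => t _; apply: leq_trans (cle t) _; lia.
Qed.

(** The iteration beyond [max_edges] is for the edge that causes a rejection. *)
Lemma runs_parse s :
  (forall p, arr s aInput p = nth 0 input p) ->
  [/\ reg s nedges = m, reg s cur = 0, reg s bad = 0, reg s span = 0 & reg s hor = 0] ->
  (forall t, arr s aHead t = 0 /\ arr s aCover t = 0) ->
  runs parse s (max_edges.+1 * (edge_time + 4) + 20) (fun s' =>
    parsed s' m \/ (reg s' bad != 0 /\ overloaded)).
Proof.
move=> inp [nm c0 b0 sp0 h0] z0.
apply: (runs_seq_lf (T2 := max_edges.+1 * (3 + edge_time).+1 + 4)) => // [|s1 fr1 e1].
  by rewrite /=; lia.
pose I k s' := (exists2 i, i <= m /\ i + k = max_edges.+1 & parsed s' i) \/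
  [/\ reg s' bad != 0, reg s' nedges = 0 & overloaded].
apply: (runs_while (I := I)).
- left; exists 0 => //; rewrite e1; split=> //=.
  + by rewrite drop0.
  + split=> [|t]; last by have [-> _] := z0 t.
    by split=> // t /=; have [-> _] := z0 t.
  + by split=> // t; have [_ ->] := z0 t.
- move=> k s2 fr [[i [im ik] pr]|[_ n0 _]] /=; last by rewrite n0 sub0n.
  have [[ci ni _] _ _ _ _] := pr; rewrite ci ni => cond.
  have le := parsed_le im pr; split; first by lia.
  have lt : i < m by lia.
  apply: runs_weaken (runs_read_edge lt pr _) _ _ => //.
    by move=> p; rewrite (fr.2 aInput) // (fr1.2 aInput).
  by move=> s3 _ [pr3|ov]; [left; exists i.+1 => //; lia | right].
- move=> k s2 fr [[i [im ik] pr]|[bd n0 ov]] /=; last by right.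
  have [[ci ni _] _ _ _ _] := pr; rewrite ci ni => cond; left.
  by rewrite (_ : m = i) //; lia.
Qed.

Lemma overloaded_no_trail x w : overloaded -> ~ eulerian_trail es x w.
Proof.
move=> ov [tr sz _]; case: ov => [[i im t0]|[i [t [im lt]]]].
  have: i \in unzip1 w by rewrite (perm_mem (trail_perm tr sz)) mem_iota.
  by case/mapP => et inw ii; have := trail_times tr inw; rewrite -ii t0.
have := cover_le_trail t tr sz im (fun j => @span_le_max_span es i j).
by rewrite leqNgt lt.
Qed.

Hypothesis loopless : forall i, i < m -> end1 es i != end2 es i.

Definition decide_time :=
  m * 110 + sweep_time es (candidates es (min_last es m) m) D +
  max_records (candidates es (min_last es m) m) D * 30 + 60.

Lemma runs_decide s : 0 < m -> parsed s m ->
  [/\ reg s top = 0, reg s base = 0 & reg s res = 0] -> (forall c, arr s aSeen c = 0) ->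
  runs decide s decide_time (fun s' =>
    accepting s' <-> exists x w, eulerian_trail es x w).
Proof.
move=> m0 [[_ nm _] _ [ld _] [wt _ hr] [_ cle ne]] [tp bs rs0] sn.
set starts := candidates es (min_last es m) m.
have cov t : coverage es m t <= D.*2.+1.
  by apply: leq_trans (cle t) _; rewrite ltnS leq_double; apply: max_span_le.
have eq_ld p s' s'' : framed p s' s'' -> all (leq 10) (arr_mods p) ->
    loaded_upto es m s' -> loaded_upto es m s''.
  move=> fr /allP h; apply: eq_loaded => a q ha; apply: fr.2.
  by apply/negP => /h; rewrite leqNgt ha.
apply: (runs_seq (T2 := m * 90 + sweep_time es starts D + max_records starts D * 30 +
  40)
  (runs_find_min ld nm m0)); last by rewrite /decide_time -/starts; lia.
move=> s1 fr1 mn1; have ld1 := eq_ld _ _ _ fr1 isT ld.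
apply: (runs_seq (T2 := sweep_time es starts D + max_records starts D * 30 + 20)
  (runs_seed ld1 _ _ mn1 _ _)); rewrite ?fr1.1 //; last by lia.
move=> s2 fr2 sd2; have ld2 := eq_ld _ _ _ fr2 isT ld1.
apply: (runs_seq (T2 := max_records starts D * 30 + 20)
  (runs_sweep (starts := starts) span_le cov loopless ne ld2 _ (seeded_segment sd2) _
    _)).
- by rewrite (fr2.1 hor) // fr1.1.
- by case: sd2.
- by move=> c; rewrite (fr2.2 aSeen) // (fr1.2 aSeen).
- move=> s3 fr3 sw3.
  apply: (runs_weaken (runs_accept cov loopless ne sw3 _)); last 1 first.
  + by move=> s4 _ ->; apply: iff_sym; exact: search_correct.
  + by rewrite (fr3.1 res) // (fr2.1 res) // fr1.1.
  + by lia.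
- by lia.
Qed.

End Parse.

(** Here [E] stands for [2 ^ D] and [Y] for the lifetime, raised to at least 1. Factors linear in
    [D] are absorbed by [D < E]. The dominant term is [h * R] times the work per record, with
    [E ^ 3] from [R] and [E ^ 2] from that work. *)
Lemma total_time_le D H m h R E Y :
  D < E -> 0 < Y -> H <= Y.*2 -> m <= H * D.*2.+1 -> h <= H -> R <= 8 * E ^ 3 ->
  (H * D.*2.+1).+1 * (D.+1 * 90 + 150 + 4) + 20 +
  (m * 110 + (h * (R * (D.*2.+1 * (22 * D + 40) + D.*2.+1 * (22 * D + 200) + 120 + 4)
    + 14) + 20)
    + R * 30 + 60) + 30 <= 2 ^ 16 * E ^ 5 * Y.
Proof.
move=> DE Y0 HY mN hH RE.
have E0 : 0 < E by exact: leq_ltn_trans DE.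
have pw a b : a <= b -> E ^ a <= E ^ b by exact: leq_pexp2l.
set P := E ^ 5 * Y.
have P2 : E ^ 2 * Y <= P by rewrite leq_mul2r pw ?orbT.
have P1 : E * Y <= P by rewrite leq_mul2r -{1}[E]expn1 pw ?orbT.
have P3 : E ^ 3 <= P by rewrite -[E ^ 3]muln1 leq_mul ?pw.
have P0 : 0 < P by rewrite muln_gt0 expn_gt0 E0.
have d2 : D.*2.+1 <= 2 * E by lia.
have N1 : H * D.*2.+1 <= 4 * (E * Y).
  by apply: leq_trans (leq_mul HY d2) _; rewrite -muln2; lia.
have A1 : (H * D.*2.+1).+1 * (D.+1 * 90 + 150 + 4) <= 1220 * P.
  apply: (@leq_trans (5 * (E * Y) * (244 * E))).
    by apply: leq_mul; [have : 0 < E * Y by rewrite muln_gt0 E0|]; lia.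
  by apply: (@leq_trans (1220 * (E ^ 2 * Y))); [rewrite expnS expn1|]; lia.
have pt : D.*2.+1 * (22 * D + 40) + D.*2.+1 * (22 * D + 200) + 120 + 4 <= 604 * E ^ 2.
  have b1 : D.*2.+1 * (22 * D + 40) <= 2 * E * (40 * E) by apply: leq_mul; lia.
  have b2 : D.*2.+1 * (22 * D + 200) <= 2 * E * (200 * E) by apply: leq_mul; lia.
  have b3 : 0 < E * E by rewrite muln_gt0 E0.
  by rewrite expnS expn1; lia.
have A2 : R * (D.*2.+1 * (22 * D + 40) + D.*2.+1 * (22 * D + 200) + 120 + 4) + 14 <=
  4846 * E ^ 5.
  have b1 := leq_mul RE pt; have b2 : 0 < E ^ 5 by rewrite expn_gt0 E0.
  have b3 : 8 * E ^ 3 * (604 * E ^ 2) = 4832 * E ^ 5 by rewrite (expnD E 3 2); lia.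
  by move: b1; rewrite b3; lia.
have A3 := leq_mul (leq_trans hH HY) A2.
have b4 : Y.*2 * (4846 * E ^ 5) = 2 * 4846 * P.
  by rewrite -mul2n mulnACA [Y * _]mulnC.
rewrite b4 in A3; rewrite -mulnA -/P.
have -> : 2 ^ 16 = 16 * 4096 by rewrite (expnD 2 4 12).
have A4 : m <= 4 * P by apply: leq_trans mN (leq_trans N1 _); rewrite leq_mul2l P1.
have A5 : R <= 8 * P by apply: leq_trans RE _; rewrite leq_mul2l P3.
move: P0 A1 A3 A4 A5; clear P1 P2 P3 b4; clearbody P;
  move: (_ * (D.+1 * 90 + 150 + 4)) (h * _); clear; lia.
Qed.

Theorem theorem5p4 :
  exists (P : program) (c : nat),
  forall (V : finType) (G : temporal_graph V) (k u : nat),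
    temp_euler_instance G k ->
    consecutive_gaps_at_most G u ->
    forall input : seq nat, encodes G input ->
    decides_within P input
      (2 ^ (c * (k * u) + c) * maxn 1 (lifetime G))
      (temporally_eulerian G).
Proof.
(* One constant serves twice: [2 ^ 16] absorbs the numerical factors, and the power 5 of
   [2 ^ (k * u)] is at most 16. *)
exists main_program, 16 => V G k u hk hu input [num [rs [[num_inj _] rsE rsT inpE]]].
pose es := instance_of num rs; pose D := k * u; pose H := (lifetime G).+1.
have szE : size es = size rs by exact: size_instance.
have spanE i : i < size es -> last_time es i - first es i <= D.
  exact: (times_span rsE rsT hk hu).
have lastE i : i < size es -> last_time es i < H.
  by rewrite ltnS; exact: (last_time_le_lifetime rsE rsT).
have uniqE i : i < size es -> uniq (times es i) by exact: (times_uniq rsE rsT).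
have loopE i : i < size es -> end1 es i != end2 es i.
  exact: (instance_loopless num_inj rsE rsT).
have inpE' : drop 2 input = flatten (map encode_numbers es).
  by rewrite inpE /= drop0 /es /instance_of -map_comp.
set T := _ * _.
set s0 := initial_state input.
have s0E p : arr s0 aInput p = nth 0 input p by [].
suff : runs main_program s0 T (fun s => accepting s <-> temporally_eulerian G) by [].
have T0 : 2 ^ 16 <= T.
  by rewrite /T expnD -mulnA mulnCA leq_pmulr // muln_gt0 expn_gt0 leq_maxl.
apply: (runs_seq_lf (T2 := T - 10)) => // [|s1 fr1 e1]; first by rewrite /=; lia.
have nm1 : reg s1 nedges = size es by rewrite e1 /= inpE /= szE.
apply: (runs_weaken (T := (1 + (T - 15)).+1) _ _ (fun _ _ h => h)); last by lia.
apply: runs_if; rewrite /= nm1 => m0; last first.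
  apply: runs_lf => //=; first by lia.
  rewrite /accepting /= e1 /= inpE /=.
  have rs0 : rs = [::] by apply: size0nil; rewrite -szE.
  have E0 e : e \in tg_edges G = false by rewrite -(mem_edge_sets rsE) rs0.
  rewrite -lt0n; split=> [/card_gt0P[x _]|[w [[x _] _]]]; last by apply/card_gt0P;
    exists x.
  by exists [::]; split; [exists x | split=> [|e]; [exists x | rewrite E0]].
rewrite -lt0n in m0; have rs0 : 0 < size rs by rewrite -szE.
have iffE := temporally_eulerianE num_inj rsE rsT rs0; rewrite -/es in iffE.
have eqr1 x : x != nedges -> reg s1 x = 0 by move=> hx; rewrite fr1.1 // inE.
have le_T : 2 ^ 16 * (2 ^ D) ^ 5 * maxn 1 (lifetime G) <= T.
  rewrite /T leq_mul2r -expnM addnC expnD leq_mul2l.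
  by rewrite leq_exp2l // !(mulnC _ 5, mulnC _ 16) leq_mul2r !orbT.
(* There are [lifetime G + 1] possible times; the maximum with 1 makes doubling sufficient also when
   the lifetime is 0. *)
have HY : H <= (maxn 1 (lifetime G)).*2 by rewrite /H; lia.
have Y0 : 0 < maxn 1 (lifetime G) by rewrite leq_maxl.
pose Tp := (max_edges D H).+1 * (edge_time D + 4) + 20.
(* The general estimate with no edges, horizon 0 and no records bounds the parsing alone, before it
   is known whether the input gets rejected. *)
have TpT : Tp + 30 <= T.
  apply: leq_trans (leq_trans (total_time_le (ltn_expl D _) Y0 HY (leq0n _) (leq0n _)
    (leq0n _)) le_T) => //.
  by rewrite /Tp /edge_time /max_edges; lia.
apply: (runs_seq (T2 := T - 15 - Tp) (runs_parse (s := s1) inpE' uniqE spanE lastE _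
  _ _)).
- by move=> p; rewrite (fr1.2 aInput).
- by split=> //; exact: eqr1.
- by move=> t; rewrite !(fr1.2 _ t).
- move=> s2 fr2 h2.
  apply: (runs_weaken (T := (1 + (T - 20 - Tp)).+1) _ _ (fun _ _ h => h)); last by lia.
  case: h2 => [pr|[bd ov]]; last first.
    apply: runs_if => /= [_|b0]; last by rewrite b0 in bd.
    apply: runs_lf => //=; first by lia.
    rewrite /accepting (fr2.1 res) // eqr1 // eqxx iffE; split=> // -[x [w et]].
    by case: (overloaded_no_trail ov et).
  apply: runs_if => /= bd2; first by have [[_ _ b0] _ _ _ _] := pr; rewrite b0 in bd2.
  apply: (runs_weaken (T := decide_time es D)).
  + apply: (runs_decide (input := input)) => //.
    * by split; rewrite fr2.1 ?eqr1.
    * by move=> c; rewrite (fr2.2 aSeen) // (fr1.2 aSeen).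
  + have mle := parsed_le spanE lastE (leqnn _) pr.
    have [_ _ _ _ [_ cle _]] := pr.
    have cov t : coverage es (size es) t <= D.*2.+1.
      by apply: leq_trans (cle t) _; rewrite ltnS leq_double; apply: max_span_le.
    have DE := ltn_expl D (isT : 1 < 2).
    set starts := candidates es (min_last es (size es)) (size es).
    have RE : max_records starts D <= 8 * (2 ^ D) ^ 3.
      (* At most [2 (2D + 1)] candidates, and [D + 1 <= 2 ^ D]. *)
      have szs : size starts <= 4 * 2 ^ D.
        apply: leq_trans (size_candidates _ (leqnn _)) _;
          have := cov (min_last es (size es)); lia.
      apply: leq_trans (leq_mul szs (leqnn _)) _.
      by rewrite expnS -addnn expnD !expnS expn0 muln1; move: (2 ^ D) => E; lia.
    have hH : horizon es (size es) <= H by exact: horizon_le.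
    have := total_time_le DE Y0 HY mle hH RE.
    rewrite -/(process_time D) => /leq_trans/(_ le_T).
    by rewrite /decide_time /sweep_time -/starts /Tp /edge_time /max_edges; lia.
  + by move=> s3 _ h; rewrite h iffE.
- by rewrite -/Tp; lia.
Qed.
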